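(* Let $n\ge 1$. The set $\mathcal{A}^s_n\subset B_n$ of signed arc permutations is $\mathcal{G}$-positive. Moreover, $$\sum_{\pi \in \mathcal{A}^s_{n}} F^B_{Des(\pi)} = \mathcal{G}_{(2n)} + \mathcal{G}_{(2n-1, 1)} + \mathcal{G}_{(2n-2, 1, 1)} + \mathcal{G}_{(2n-3, 1, 1, 1)}+ 2 \sum_{a \ge 2n-a \ge 2} \mathcal{G}_{(a, 2n-a)} + \sum_{a \ge 2n-a-2 \ge 2} \mathcal{G}_{(a, 2n-a-2, 2)} + \sum_{a \ge 2n-a-2 \ge 2}\mathcal{G}_{(a, 2n-a-2, 1, 1)},$$ where the sums run over integers $a$ satisfying the indicated inequalities.
   Context: Write $[n]=\{1,\dots,n\}$. $B_n$ is the hyperoctahedral group of all permutations $\pi$ of $\{-n,\dots,-1,0,1,\dots,n\}$ with $\pi(-i)=-\pi(i)$ for all $i$ (so $\pi(0)=0$). For $\pi\in B_n$, $Des(\pi)=\{0\le i\le n-1 \mid \pi(i)>\pi(i+1)\}$. A permutation $\pi\in B_n$ is a signed arc permutation if for every $1\le i\le n$ the set $\{|\pi(1)|,\dots,|\pi(i-1)|\}$ is an interval in $\mathbb{Z}_n$ (cyclic interval of $[n]$ identified with $\mathbb{Z}_n$), and for every $1\le i\le n-1$: $\pi(i)>0$ if $|\pi(i)|-1\in\{|\pi(1)|,\dots,|\pi(i-1)|\}$, and $\pi(i)<0$ if $|\pi(i)|+1\in\{|\pi(1)|,\dots,|\pi(i-1)|\}$ (addition in $\mathbb{Z}_n$).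 No sign condition is imposed on the last entry $\pi(n)$. $\mathcal{A}^s_n$ is the set of signed arc permutations. Let $X=\{x_0,x_1,x_2,\dots\}$ be commuting indeterminates. For $I\subseteq\{0\}\cup[n-1]$, Chow's type B fundamental quasisymmetric function is $$F^B_I(X)=\sum_{\substack{0=i_0\le i_1\le\dots\le i_n\\ j\in I\Rightarrow i_j<i_{j+1}}}x_{i_1}x_{i_2}\cdots x_{i_n}.$$ Young diagrams are drawn with left-justified rows, row 1 on top. $\mathcal{P}^0(n)$ is the set of partitions $\lambda$ of $2n$ whose Young diagram can be tiled by dominoes ($1\times 2$ or $2\times 1$ rectangles), i.e. with empty 2-core. For $\lambda\in\mathcal{P}^0(n)$, a semistandard domino tableau of shape $\lambda$ is a tiling of the diagram of $\lambda$ by dominoes labelled with integers in $\{0,1,2,\dots\}$ such that labels are non-decreasing along rows and strictly increasing down columns (comparing distinct dominoes), and such that, if the domino containing the top-left box is vertical, it is not labelled $0$. $SSDT(\lambda)$ is the set of these. For $T\in SSDT(\lambda)$ with $\mu_i$ dominoes labelled $i$, put $X^T=x_0^{\mu_0}x_1^{\mu_1}x_2^{\mu_2}\cdots$. The domino function is $\mathcal{G}_\lambda(X)=\sum_{T\in SSDT(\lambda)}X^T$. For $\mathcal{B}\subset B_n$, put $\mathcal{Q}(\mathcal{B})(X)=\sum_{\pi\in\mathcal{B}}F^B_{Des(\pi)}(X)$. The set $\mathcal{B}$ is called $\mathcal{G}$-positive (type B Schur positive) if $\mathcal{Q}(\mathcal{B})$ can be written as a sum of domino functions $\mathcal{G}_\lambda$,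 $\lambda\in\mathcal{P}^0(n)$, with non-negative coefficients. Convention: a term $\mathcal{G}_{\lambda}$ whose index is not a partition is $0$ (this only concerns $(2n-2,1,1)$ and $(2n-3,1,1,1)$ when $n=1$). *)

(* Defs.v *)
From mathcomp Require Import all_boot all_order all_algebra all_fingroup.
From mathcomp Require Import finmap multiset.
From mathcomp Require Import boolp classical_sets functions cardinality fsbigop.

Set Implicit Arguments.
Unset Strict Implicit.
Unset Printing Implicit Defensive.

Import Order.TTheory GRing.Theory Num.Theory.

Local Open Scope fset_scope.
Local Open Scope mset_scope.
Local Open Scope classical_set_scope.
Local Open Scope ring_scope.

(* A multiset m of indices stands for the monomial \prod_k x_k ^ (m k), and a
   formal power series in x_0, x_1, x_2, ... is its coefficient function. The
   additive structure is the pointwise one of functions.v. *)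
Notation series := ({mset nat} -> int).

(* The formal sum of the monomials wt t, t in A. The index sets used below are
   infinite, but wt has finite fibres on them, so that the finitely supported
   sum is the actual number of t in A with wt t = m. *)
Definition genfun (T : choiceType) (A : set T) (wt : T -> {mset nat}) : series :=
  fun m => \sum_(t \in A) ((wt t == m)%:R : int).

(* The set {-n, ..., n} is represented by 'I_(2 * n).+1 through i |-> i - n;
   rev_ord is then the map x |-> -x. *)
Definition hyperoct (n : nat) : {set {perm 'I_(2 * n).+1}} :=
  [set pi : {perm 'I_(2 * n).+1} |
    [forall i, pi (rev_ord i) == rev_ord (pi i)]].

(* pi(i), for 0 <= i <= n *)
Definition pval (n : nat) (pi : {perm 'I_(2 * n).+1}) (i : nat) : int :=
  (pi (inord (n + i)) : nat)%:Z - n%:Z.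

Definition Des (n : nat) (pi : {perm 'I_(2 * n).+1}) : {set 'I_n} :=
  [set i : 'I_n | pval pi i > pval pi i.+1].

(* A sequence s of natural numbers also denotes the set of the residues mod n
   of its elements. *)
Definition inZmod (n : nat) (s : seq nat) (x : nat) : bool :=
  has (fun y => x == y %[mod n]) s.

Definition cyclic_interval (n : nat) (s : seq nat) : bool :=
  [exists a : 'I_n, exists k : 'I_n.+1,
    [forall x : 'I_n, inZmod n s x == inZmod n (iota a k) x]].

(* |pi(1)|, ..., |pi(i-1)| *)
Definition abs_prefix (n : nat) (pi : {perm 'I_(2 * n).+1}) (i : nat) : seq nat :=
  [seq `|pval pi j|%N | j <- iota 1 i.-1].

Definition signed_arc (n : nat) : {set {perm 'I_(2 * n).+1}} :=
  [set pi in hyperoct n |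
    all (fun i => cyclic_interval n (abs_prefix pi i)) (iota 1 n)
    && all (fun i =>
         (inZmod n (abs_prefix pi i) (`|pval pi i|%N - 1)%N ==> (0 < pval pi i))
         && (inZmod n (abs_prefix pi i) (`|pval pi i|%N + 1)%N ==> (pval pi i < 0)))
       (iota 1 n.-1)].

(* The n-tuple s is (i_1, ..., i_n), and the j-th item of 0 :: s is i_j. *)
Definition fundB (n : nat) (I : {set 'I_n}) : series :=
  genfun
    [set s : n.-tuple nat | path leq 0%N s /\
       forall j : 'I_n, j \in I -> (nth 0 (0 :: s) j < nth 0 (0 :: s) j.+1)%N]
    (fun s => seq_mset s).

Definition quasisym (n : nat) (B : {set {perm 'I_(2 * n).+1}}) : series :=
  \sum_(pi in B) fundB (Des pi).

Definition is_partition (lam : seq nat) : bool :=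
  sorted geq lam && (0%N \notin lam).

(* The box (i, j) lies in row i from the top and column j from the left, both
   numbered from 0. *)
Definition in_diagram (lam : seq nat) (c : nat * nat) : bool :=
  (c.2 < nth 0 lam c.1)%N.

(* The domino (c, v) has c as its top or left box, and is vertical iff v. *)
Definition domino : Type := ((nat * nat) * bool)%type.

Definition vertical (d : domino) : bool := d.2.

Definition boxes (d : domino) : seq (nat * nat) :=
  [:: d.1; if vertical d then (d.1.1.+1, d.1.2) else (d.1.1, d.1.2.+1)].

Definition domino_tiling (lam : seq nat) (D : {fset domino}) : Prop :=
  (forall d, d \in D -> all (in_diagram lam) (boxes d)) /\
  (forall c, in_diagram lam c -> exists! d, d \in D /\ c \in boxes d).

Definition P0 (n : nat) : set (seq nat) :=
  [set lam | [/\ is_partition lam, sumn lam = (2 * n)%N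
               & exists D, domino_tiling lam D]].

(* A labelled tiling is a finite map from dominoes to labels, whose domain is
   the tiling. *)
Definition SSDT (lam : seq nat) : set {fmap domino -> nat} :=
  [set T | [/\ domino_tiling lam (domf T),
     (forall (d e : domf T) i j k, d != e ->
        (i, j) \in boxes (val d) -> (i, k) \in boxes (val e) ->
        (j < k)%N -> (T d <= T e)%N),
     (forall (d e : domf T) i j k, d != e ->
        (i, k) \in boxes (val d) -> (j, k) \in boxes (val e) ->
        (i < j)%N -> (T d < T e)%N)
   & (forall d : domf T,
        (0%N, 0%N) \in boxes (val d) -> vertical (val d) -> T d != 0%N)]].

(* By convention the domino function is 0 if lam is not a partition. *)
Definition domfun (lam : seq nat) : series :=
  if is_partition lam
  then genfun (SSDT lam) (fun T => seq_mset [seq T d | d : domf T])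
  else 0.

Definition G_positive (n : nat) (B : {set {perm 'I_(2 * n).+1}}) : Prop :=
  exists c : seq nat -> nat,
    quasisym B = \sum_(lam \in P0 n) domfun lam *+ c lam.

(* Main.v *)
(* Fix a monomial; it determines the weakly increasing sequence of its labels.
   Both sides are counted through words of signs that are weakly decreasing
   (negatives first) on each block of equal labels, with no negative sign at
   label 0. Call a piece a nonempty maximal run of equal signs within a block,
   and let P and M be the numbers of positive and negative pieces.

   A signed arc permutation amounts to an arbitrary sign word together with a
   residue b in Z_n: its positive entries are b + 1, b + 2, ... and the absolute
   values of its negative entries b, b - 1, ... modulo n. Within a piece the only
   possible descent is the passage between n and 1, which occurs for exactly one b
   at each of the n - P - M inner steps of pieces; so P + M permutations with
   these signs are compatible with the labels.

   Removing the dominoes with the largest label from a domino tableau leaves a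
   domino tableau, and a horizontal strip of dominoes has at most one tiling. In
   terms of 2-quotients this is the removal of a horizontal strip from each
   component, the second component losing nothing at label 0. Recursively, the
   shape with quotient ((p), (q)) has one tableau for each word with p positive
   and q negative signs, ((p + 1, 1), (q)) has P - 1 for each word with p + 2 and
   q, and ((p), (q + 1, 1)) has M - 1 for each word with p and q + 2. The shapes
   of the theorem are exactly those for which these numbers add up to P + M. *)

Require Import Defs.
From mathcomp Require Import all_boot all_order all_algebra all_fingroup.
From mathcomp Require Import finmap multiset.
From mathcomp Require Import boolp classical_sets functions cardinality fsbigop.
From mathcomp Require Import zify ring.

Set Implicit Arguments.
Unset Strict Implicit.
Unset Printing Implicit Defensive.

Import Order.TTheory GRing.Theory Num.Theory.

Local Notation pval := Defs.pval.

(** * Horizontal domino strips *)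

Definition cov (d : domino) (i j : nat) : bool := (i, j) \in boxes d.

Lemma covE a b (t : bool) i j :
  cov ((a, b), t) i j =
  if t then (j == b) && ((i == a) || (i == a.+1))
  else (i == a) && ((j == b) || (j == b.+1)).
Proof.
rewrite /cov /boxes /vertical; case: t; rewrite !inE /= !xpair_eqE; lia.
Qed.

Definition weakly_decreasing (l : nat -> nat) := forall i, (l i.+1 <= l i)%N.

Lemma weakly_decreasing_le (l : nat -> nat) :
  weakly_decreasing l -> forall i j, (i <= j)%N -> (l j <= l i)%N.
Proof.
move=> ld i j /subnKC <-; elim: (j - i)%N => [|k IH]; first by rewrite addn0.
by rewrite addnS; apply: leq_trans (ld _) IH.
Qed.

(* In row i of the skew shape l/m, the boxes that are not covered by vertical
   dominoes are those in the columns strip_start l m i, ..., strip_end l m i - 1. *)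
Definition strip_start (l m : nat -> nat) (i : nat) := maxn (m i) (l i.+1).

Definition strip_end (l m : nat -> nat) (i : nat) :=
  if i is i'.+1 then minn (l i) (m i') else l i.

(** The only candidate for a tiling: vertical dominoes in the columns that two successive rows of
    [l/m] share, horizontal ones packed from the left end of each remaining segment, whence the
    parity test. *)
Definition in_strip (l m : nat -> nat) (d : domino) : bool :=
  if d.2 then (m d.1.1 <= d.1.2 < l d.1.1.+1)%N
  else [&& strip_start l m d.1.1 <= d.1.2, d.1.2.+1 < strip_end l m d.1.1
         & ~~ odd (d.1.2 - strip_start l m d.1.1)]%N.

Lemma strip_end_le l m i : (strip_end l m i <= l i)%N.
Proof. by case: i => [|i] //=; apply: geq_minl. Qed.

Lemma in_stripE l m a b (t : bool) : in_strip l m ((a, b), t) =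
  if t then (m a <= b < l a.+1)%N
  else [&& strip_start l m a <= b, b.+1 < strip_end l m a
         & ~~ odd (b - strip_start l m a)]%N.
Proof. by []. Qed.

Definition skew_strip (l m : nat -> nat) := forall i,
  [/\ m i <= l i, l i.+2 <= m i & m i.+1 <= m i]%N.

(* l/m can be tiled by dominoes no two of which share a column. *)
Definition hstrip (l m : nat -> nat) := skew_strip l m /\
  forall i, ~~ odd (strip_end l m i - strip_start l m i).

Lemma in_strip_sub l m d i j : weakly_decreasing l -> skew_strip l m ->
  in_strip l m d -> cov d i j -> (m i <= j < l i)%N.
Proof.
case: d => [[a b] t] ld ss; rewrite in_stripE covE.
have := ld a; have := ld a.+1; have [] := ss a.
have := strip_end_le l m a; rewrite /strip_start; case: t; last first.
  move=> ? ? ? ? ? ? /and3P[H1 H2 _] /andP[/eqP -> H3]; lia.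
move=> ? ? ? ? ? ? ? /andP[/eqP -> /orP[/eqP ->|/eqP ->]]; lia.
Qed.

(** A column has at most two boxes of [l/m], in adjacent rows, and two such boxes form one vertical
    domino; so a column determines its domino. The case [i = j] says that the dominoes are
    disjoint. *)
Lemma in_strip_col_uniq l m d e i j k : weakly_decreasing l -> skew_strip l m ->
  in_strip l m d -> in_strip l m e -> cov d i k -> cov e j k -> d = e.
Proof.
move=> ld ss; have md : weakly_decreasing m by move=> x; case: (ss x).
have lle := weakly_decreasing_le ld; have mle := weakly_decreasing_le md.
case: d => [[a b] t]; case: e => [[a' b'] t'] Hd He Cd Ce.
have Id := in_strip_sub ld ss Hd Cd; have Ie := in_strip_sub ld ss He Ce.
have Hij x y : (m x <= k < l x)%N -> (m y <= k < l y)%N -> ~~ (x.+1 < y)%N.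
  move=> Hx Hy; apply/negP => xy; have := lle _ _ xy; have [_ + _] := ss x; lia.
(* Column [k] lies outside the horizontal segments of rows [x] and [x.+1], so a strip domino through
   either box is the vertical one. *)
have vert x : (m x <= k < l x)%N -> (m x.+1 <= k < l x.+1)%N ->
    forall u v s y, y = x \/ y = x.+1 -> in_strip l m ((u, v), s) -> cov ((u, v), s) y k ->
    [/\ u = x, v = k & s].
  move=> Hx Hx1 u v s y yx; rewrite in_stripE covE.
  case: s => [H1 /andP[/eqP kb ya]|].
    subst v; split=> //.
    have ia : (m u <= k < l u)%N by have := ld u; lia.
    have ia1 : (m u.+1 <= k < l u.+1)%N by have := md u; lia.
    have := Hij _ _ ia Hx1; have := Hij _ _ Hx ia1; lia.
  rewrite /strip_start /strip_end => /and3P[H1 H2 H3] /andP[/eqP ya kb].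
  case: yx => yx; first by subst u y; lia.
  subst u y; lia.
have [ij|ij|ij] := ltngtP i j.
- have ej : j = i.+1 by have := Hij _ _ Id Ie; lia.
  subst j.
  have [-> -> tt] := vert _ Id Ie _ _ _ _ (or_introl erefl) Hd Cd.
  by have [-> -> tt'] := vert _ Id Ie _ _ _ _ (or_intror erefl) He Ce; rewrite tt tt'.
- have ej : i = j.+1 by have := Hij _ _ Ie Id; lia.
  subst i.
  have [-> -> tt] := vert _ Ie Id _ _ _ _ (or_intror erefl) Hd Cd.
  by have [-> -> tt'] := vert _ Ie Id _ _ _ _ (or_introl erefl) He Ce; rewrite tt tt'.
subst j.
case: t t' Hd He Cd Ce => [] [] Hd He Cd Ce.
- move: (Cd) (Ce); rewrite !covE => /andP[/eqP kb ia] /andP[/eqP kb' ia'].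
  have i1 : (m a <= k < l a)%N /\ (m a.+1 <= k < l a.+1)%N.
    by move: Hd; rewrite in_stripE; have := ld a; have := md a; lia.
  have [-> -> _] := vert _ i1.1 i1.2 _ _ _ i ltac:(lia) He Ce.
  by rewrite kb.
- move: (Cd); rewrite !covE => /andP[/eqP kb ia].
  have i1 : (m a <= k < l a)%N /\ (m a.+1 <= k < l a.+1)%N.
    by move: Hd; rewrite in_stripE; have := ld a; have := md a; lia.
  by have [] := vert _ i1.1 i1.2 _ _ _ i ltac:(lia) He Ce.
- move: (Ce); rewrite !covE => /andP[/eqP kb ia].
  have i1 : (m a' <= k < l a')%N /\ (m a'.+1 <= k < l a'.+1)%N.
    by move: He; rewrite in_stripE; have := ld a'; have := md a'; lia.
  by have [] := vert _ i1.1 i1.2 _ _ _ i ltac:(lia) Hd Cd.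
- move: Hd He Cd Ce; rewrite !in_stripE !covE.
  move=> + + /andP[/eqP -> ka] /andP[/eqP e2 kb].
  rewrite e2 => H1 H2; have -> : b = b' by lia.
  by [].
Qed.

Lemma in_strip_cover l m i j : weakly_decreasing l -> hstrip l m ->
  (m i <= j < l i)%N -> exists d, in_strip l m d /\ cov d i j.
Proof.
move=> ld [ss par] ij.
have [H|H] := leqP (l i.+1) j; last first.
  by exists ((i, j), true); rewrite in_stripE covE; split; lia.
have [H'|H'] := leqP (strip_end l m i) j.
  case: i ij H H' => [|i] ij H H' /=; first by move: H'; rewrite /=; lia.
  exists ((i, j), true); rewrite in_stripE covE; split; last by lia.
  by move: H'; rewrite /strip_end; lia.
have pi := par i.
have Hs : (strip_start l m i <= j)%N by rewrite /strip_start; lia.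
(* The segment is tiled in pairs from its left end; its even length leaves room for the right
   box. *)
exists ((i, (j - odd (j - strip_start l m i))%N), false); rewrite in_stripE covE.
move: (strip_start _ _ _) (strip_end _ _ _) Hs H' pi => s e; split; lia.
Qed.

(** * Removing the largest label *)

Definition lab (T : {fmap domino -> nat}) (d : domino) : nat := odflt 0 (T.[? d])%fmap.

Lemma lab_val (T : {fmap domino -> nat}) (d : domf T) : lab T (val d) = T d.
Proof. by rewrite /lab -Some_fnd. Qed.

Lemma lab_ext (T U : {fmap domino -> nat}) :
  domf T = domf U -> {in domf T, lab T =1 lab U} -> T = U.
Proof.
move=> eD eL; apply/fmapP => d; have := eL d; rewrite /lab.
have : (d \in domf T) = (d \in domf U) by rewrite eD.
by do 2!case: fndP => //= ?; move=> // _ ->.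
Qed.

(** [SSDT] for row lengths given by any function, so that it applies to the part of a tableau below
    a label before that part is known to have a partition shape. *)
Record ssdt (l : nat -> nat) (T : {fmap domino -> nat}) : Prop := {
  ssdt_sub : forall d i j, d \in domf T -> cov d i j -> (j < l i)%N;
  ssdt_cover : forall i j, (j < l i)%N -> exists d, d \in domf T /\ cov d i j;
  ssdt_uniq : forall d e i j, d \in domf T -> e \in domf T ->
    cov d i j -> cov e i j -> d = e;
  ssdt_row : forall d e i j k, d \in domf T -> e \in domf T -> d != e ->
    cov d i j -> cov e i k -> (j < k)%N -> (lab T d <= lab T e)%N;
  ssdt_col : forall d e i j k, d \in domf T -> e \in domf T -> d != e ->
    cov d i k -> cov e j k -> (i < j)%N -> (lab T d < lab T e)%N;
  ssdt_top : forall d, d \in domf T -> cov d 0 0 -> d.2 -> lab T d != 0 }.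

Lemma SSDT_ssdt lam T : SSDT lam T <-> ssdt (nth 0 lam) T.
Proof.
split=> [[[sub tile] row col top]|[sub cover uni row col top]].
  split.
  - by move=> d i j dT; have /allP dl := sub _ dT; move=> /dl.
  - by move=> i j ij; have [d [[]]] := tile (i, j) ij; exists d.
  - move=> d e i j dT eT di ei; have ij : in_diagram lam (i, j).
      by have /allP dl := sub _ dT; apply: dl.
    by have [x [_ ux]] := tile _ ij; rewrite -(ux d) ?(ux e).
  - move=> d e i j k dT eT; have := row [` dT]%fset [` eT]%fset i j k.
    by rewrite -!lab_val.
  - move=> d e i j k dT eT; have := col [` dT]%fset [` eT]%fset i j k.
    by rewrite -!lab_val.
  - by move=> d dT; have := top [` dT]%fset; rewrite -lab_val.
split.
- split=> [d dT|[i j] ij]; first by apply/allP => -[i j]; exact: sub dT.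
  have [d [dT dij]] := cover _ _ ij.
  by exists d; split=> // e [eT eij]; exact: uni dij eij.
- by move=> d e i j k de; rewrite -!lab_val; apply: row => //; exact: valP.
- by move=> d e i j k de; rewrite -!lab_val; apply: col => //; exact: valP.
- by move=> d; rewrite -lab_val; apply: top; exact: valP.
Qed.

Definition add_strip (T : {fmap domino -> nat}) (D : {fset domino}) (v : nat) :
  {fmap domino -> nat} := catf T [fmap d : D => v]%fmap.

Lemma domf_add T D v : domf (add_strip T D v) = (domf T `|` D)%fset.
Proof. by apply/fsetP => d; rewrite /add_strip mem_catf !inE. Qed.

Lemma lab_add T D v d : lab (add_strip T D v) d = if d \in D then v else lab T d.
Proof.
rewrite /lab /add_strip fnd_cat; case: ifP => // dD.
by rewrite in_fnd /= ffunE.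
Qed.

(** The strip lies to the right of [m] in rows and below it in columns, and its label exceeds the
    old ones, so the order conditions persist. The condition at [v = 0] confines the shape to one
    row, which rules out a vertical domino at the corner. *)
Lemma ssdt_add l m T D v : weakly_decreasing l -> hstrip l m ->
  (v = 0 -> l 1 = 0) -> ssdt m T -> (forall d, d \in domf T -> lab T d < v)%N ->
  (forall d, d \in D = in_strip l m d) -> ssdt l (add_strip T D v).
Proof.
move=> ld hs v0 sT Tv DE; have [ss _] := hs.
have md : weakly_decreasing m by move=> i; case: (ss i).
have Tm d i j : d \in domf T -> cov d i j -> d \notin D.
  move=> dT dij; apply/negP; rewrite DE => dD.
  by have := ssdt_sub sT dT dij; have := in_strip_sub ld ss dD dij; lia.
have TD d : d \in domf T -> d \notin D.
  by move=> dT; apply: (Tm d d.1.1 d.1.2) => //; rewrite /cov inE -surjective_pairing eqxx.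
have Dsub d i j : d \in D -> cov d i j -> (m i <= j < l i)%N.
  by rewrite DE; exact: in_strip_sub.
have labT d : d \in domf T -> lab (add_strip T D v) d = lab T d.
  by move=> /TD dD; rewrite lab_add (negPf dD).
have labD d : d \in D -> lab (add_strip T D v) d = v by rewrite lab_add => ->.
split; rewrite domf_add.
- move=> d i j /fsetUP[dT|dD] dij; last by have := Dsub _ _ _ dD dij; lia.
  by have := ssdt_sub sT dT dij; have [] := ss i; lia.
- move=> i j ij; have [jm|mj] := ltnP j (m i).
    by have [d [dT dij]] := ssdt_cover sT jm; exists d; rewrite inE dT.
  have [|d [dD dij]] := @in_strip_cover l m i j ld hs; first by rewrite mj.
  by exists d; rewrite inE DE dD orbT.
- move=> d e i j /fsetUP[dT|dD] /fsetUP[eT|eD] dij eij.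
  + exact: ssdt_uniq sT _ _ _ _ dT eT dij eij.
  + by have := ssdt_sub sT dT dij; have := Dsub _ _ _ eD eij; lia.
  + by have := ssdt_sub sT eT eij; have := Dsub _ _ _ dD dij; lia.
  + by apply: (in_strip_col_uniq ld ss _ _ dij eij); rewrite -DE.
- move=> d e i j k /fsetUP[dT|dD] /fsetUP[eT|eD] de dij eik jk.
  + by rewrite !labT //; exact: ssdt_row sT _ _ _ _ _ dT eT de dij eik jk.
  + by rewrite labT // labD //; apply: ltnW; apply: Tv.
  + by have := ssdt_sub sT eT eik; have := Dsub _ _ _ dD dij; lia.
  + by rewrite !labD.
- move=> d e i j k /fsetUP[dT|dD] /fsetUP[eT|eD] de dij eik jk.
  + by rewrite !labT //; exact: ssdt_col sT _ _ _ _ _ dT eT de dij eik jk.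
  + by rewrite labT // labD //; apply: Tv.
  + have := ssdt_sub sT eT eik; have := Dsub _ _ _ dD dij.
    by have := weakly_decreasing_le md (ltnW jk); lia.
  + have := in_strip_col_uniq ld ss _ _ dij eik.
    by rewrite -!DE => /(_ dD eD) /eqP; rewrite (negPf de).
- move=> d /fsetUP[dT|dD] d00 d2; first by rewrite labT //; exact: ssdt_top sT _ dT d00 d2.
  rewrite labD //.
  apply/eqP => /v0 l1; case: d dD d00 d2 => [[a b] t] dD + /= tt.
  rewrite tt in dD *; move=> d00; have := Dsub _ a.+1 b dD.
  by rewrite covE !eqxx orbT => /(_ isT); have := d00; rewrite covE; case: a {dD d00} => //; lia.
Qed.

Lemma down_closed_count (P : pred nat) n j :
  (forall i k, (i <= k < n)%N -> P k -> P i) ->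
  (j < count P (iota 0 n))%N = (j < n)%N && P j.
Proof.
elim: n => [|n IH] dc //; rewrite -(addn1 n) iotaD count_cat /= add0n addn0.
have dc' : forall i k, (i <= k < n)%N -> P k -> P i by move=> i k ik; apply: dc; lia.
case Pn : (P n).
  have all_n : all P (iota 0 n).
    by apply/allP => k; rewrite mem_iota => kn; apply: (dc k n); [lia|].
  have := all_n; rewrite all_count size_iota => /eqP -> /=.
  by case: ltnP => // jn; rewrite (dc j n) //; lia.
rewrite addn0 IH //; have [->|jn] := eqVneq j n; first by rewrite Pn !andbF.
by congr (_ && _); lia.
Qed.

Definition restr (T : {fmap domino -> nat}) (v : nat) : {fmap domino -> nat} :=
  T.[& [fset d in domf T | (lab T d < v)%N]%fset]%fmap.

Lemma restr_dom T v d : (d \in domf (restr T v)) = (d \in domf T) && (lab T d < v)%N.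
Proof. by rewrite mem_restrictf !inE /= andbAC andbb. Qed.

Lemma restr_lab T v d : d \in domf (restr T v) -> lab (restr T v) d = lab T d.
Proof.
rewrite /lab fnd_restrict mem_restrictf => /andP[]; rewrite /= => -> _ //.
Qed.

(** Labels do not decrease along rows, so the boxes labelled below [v] begin the row, and their
    number is the row length of the remaining shape. *)
Definition low_shape (l : nat -> nat) (T : {fmap domino -> nat}) (v : nat) (i : nat) : nat :=
  count (fun j => has (fun d => cov d i j && (lab T d < v)%N) (domf T)) (iota 0 (l i)).

Section Peel.
Variables (l : nat -> nat) (T : {fmap domino -> nat}) (v : nat).
Hypotheses (ld : weakly_decreasing l) (sT : ssdt l T)
  (Tv : forall d, d \in domf T -> (lab T d < v.+1)%N).

Let m := low_shape l T v.
Let D := [fset d in domf T | lab T d == v]%fset.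

Let lt_low i j : (j < m i)%N <-> exists d, [/\ d \in domf T, cov d i j & (lab T d < v)%N].
Proof.
rewrite /m /low_shape down_closed_count.
  split=> [/andP[_ /hasP[d dT /andP[dij dv]]]|[d [dT dij dv]]]; first by exists d.
  by rewrite (ssdt_sub sT dT dij); apply/hasP; exists d; rewrite ?dij.
move=> i' k /andP[i'k kl] /hasP[d dT /andP[dik dv]].
have [e [eT ei']] := ssdt_cover sT (leq_ltn_trans i'k kl).
apply/hasP; exists e => //; rewrite ei' /=.
have [<- //|de] := eqVneq d e.
have [ik|ik|ik] := ltngtP i' k; [|lia|].
  by apply: leq_ltn_trans dv; apply: ssdt_row sT _ _ _ _ _ eT dT _ ei' dik ik; rewrite eq_sym.
by rewrite ik in ei'; case/eqP: de; exact: ssdt_uniq sT _ _ _ _ dT eT dik ei'.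
Qed.

Let low_le i : (m i <= l i)%N.
Proof. by rewrite /m /low_shape (leq_trans (count_size _ _)) ?size_iota. Qed.

Let skew_D i j : (m i <= j < l i)%N <-> exists d, d \in D /\ cov d i j.
Proof.
split=> [/andP[mj jl]|[d [dD dij]]].
  have [d [dT dij]] := ssdt_cover sT jl; exists d; split=> //.
  rewrite !inE dT /=; have := Tv dT; rewrite ltnS leq_eqVlt => /orP[//|dv].
  by have : (j < m i)%N; [apply/lt_low; exists d|lia].
move: dD; rewrite !inE => /andP[dT /eqP dv]; rewrite (ssdt_sub sT dT dij) andbT leqNgt.
apply/negP => /lt_low[e [eT eij]].
by rewrite -(ssdt_uniq sT dT eT dij eij) dv ltnn.
Qed.

(** Strict growth down columns forbids two dominoes of the same label in a column. *)
Let D_col d e i j k : d \in D -> e \in D -> cov d i k -> cov e j k -> d = e.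
Proof.
rewrite !inE => /andP[dT /eqP dv] /andP[eT /eqP ev] dik ejk.
have [ij|ij|ij] := ltngtP i j.
- apply/eqP/negPn/negP => de.
  by have := ssdt_col sT dT eT de dik ejk ij; rewrite dv ev ltnn.
- apply/eqP/negPn/negP; rewrite eq_sym => de.
  by have := ssdt_col sT eT dT de ejk dik ij; rewrite dv ev ltnn.
- by rewrite ij in dik; exact: ssdt_uniq sT _ _ _ _ dT eT dik ejk.
Qed.

Let low_dec : weakly_decreasing m.
Proof.
move=> i; have [//|mi] := leqP (m i.+1) (m i).
have [d [dT dij dv]] := (lt_low i.+1 (m i)).1 mi.
have jl : (m i < l i)%N by have := ld i; have := low_le i.+1; lia.
have [e [eT eij]] := ssdt_cover sT jl.
have : (m i < m i)%N; last by rewrite ltnn.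
apply/lt_low; exists e; split=> //.
have [<- //|de] := eqVneq d e.
apply: ltn_trans dv.
by apply: ssdt_col sT _ _ _ _ _ eT dT _ eij dij _ => //; rewrite eq_sym.
Qed.

Let low_skew : skew_strip l m.
Proof.
move=> i; split; [exact: low_le| |exact: low_dec].
rewrite leqNgt; apply/negP => H.
(* Otherwise column [m i] has skew boxes in rows [i] and [i.+2], and a single domino would have to
   cover both. *)
have [|d [dD di]] := (skew_D i (m i)).1; first by have := ld i; have := ld i.+1; lia.
have [|e [eD ei]] := (skew_D i.+2 (m i)).1.
  by have := low_dec i; have := low_dec i.+1; lia.
have de := D_col dD eD di ei; subst e; move: di ei.
by case: d {dD eD} => [[a b] t]; rewrite !covE; case: t; lia.
Qed.

(** If a horizontal domino left the segment, the box above or below one of its halves would be skew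
    too, hence in the same domino by [D_col]. *)
Let D_horiz a b : ((a, b), false) \in D ->
  (strip_start l m a <= b /\ b.+1 < strip_end l m a)%N.
Proof.
move=> dD.
have c0 : cov ((a, b), false) a b by rewrite covE; lia.
have c1 : cov ((a, b), false) a b.+1 by rewrite covE; lia.
have i0 := (skew_D a b).2 (ex_intro _ _ (conj dD c0)).
have i1 := (skew_D a b.+1).2 (ex_intro _ _ (conj dD c1)).
split.
  rewrite /strip_start geq_max; apply/andP; split; first by lia.
  rewrite leqNgt; apply/negP => H.
  have [|e [eD ee]] := (skew_D a.+1 b).1; first by have := low_dec a; lia.
  by have de := D_col dD eD c0 ee; move: ee; rewrite -de covE; lia.
case: a dD c0 c1 i0 i1 => [|a] dD c0 c1 i0 i1 /=; first by lia.
rewrite leq_min; apply/andP; split; first by lia.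
rewrite leqNgt ltnS; apply/negP => H.
have [|e [eD ee]] := (skew_D a b.+1).1; first by have := ld a; lia.
by have de := D_col dD eD c1 ee; move: ee; rewrite -de covE; lia.
Qed.

(* Away from the columns shared with a neighbouring row, boxes are covered horizontally. *)
Let D_inner a j : (strip_start l m a <= j < strip_end l m a)%N ->
  ((a, j), false) \in D \/ exists2 j', j = j'.+1 & ((a, j'), false) \in D.
Proof.
move=> aj; have [|d [dD da]] := (skew_D a j).1.
  by have := strip_end_le l m a; move: aj; rewrite /strip_start; lia.
case: d dD da => [[a' b] []] dD; rewrite covE.
  move=> /andP[/eqP ej /orP[/eqP ea|/eqP ea]]; subst.
    have c1 : cov ((a', b), true) a'.+1 b by rewrite covE; lia.
    have := (skew_D a'.+1 b).2 (ex_intro _ _ (conj dD c1)).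
    by move: aj; rewrite /strip_start; lia.
  have c0 : cov ((a', b), true) a' b by rewrite covE; lia.
  have := (skew_D a' b).2 (ex_intro _ _ (conj dD c0)).
  by move: aj; rewrite /strip_start /strip_end; lia.
by move=> /andP[/eqP -> /orP[/eqP ->|/eqP ->]]; [left|right; exists b].
Qed.

(** Induction from the left: the box just before a horizontal domino is still in the segment, hence
    ends another horizontal domino, which starts two columns earlier. *)
Let D_parity a b : ((a, b), false) \in D -> ~~ odd (b - strip_start l m a).
Proof.
elim/ltn_ind: b => b IH bD; have [sb eb] := D_horiz bD.
have [bs|bs] := leqP b (strip_start l m a); first by lia.
have [|b1D|[b2 b2E b2D]] := @D_inner a b.-1; first by lia.
  have := D_col bD b1D (_ : cov _ a b) (_ : cov _ a b).
  by rewrite !covE => /(_ ltac:(lia) ltac:(lia)) [] ; lia.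
have [sb2 _] := D_horiz b2D.
by have := IH b2 ltac:(lia) b2D; lia.
Qed.

(** The dominoes labelled [v] belong to the strip and already cover [l/m]; any strip domino meets
    one of them and equals it by column uniqueness. *)
Lemma strip_low d : (d \in domf T) && (lab T d == v) = in_strip l (low_shape l T v) d.
Proof.
suff DE : d \in D = in_strip l m d by rewrite -DE !inE.
have DS e : e \in D -> in_strip l m e.
  case: e => [[a b] []] eD; rewrite in_stripE.
    have c0 : cov ((a, b), true) a b by rewrite covE; lia.
    have c1 : cov ((a, b), true) a.+1 b by rewrite covE; lia.
    have := (skew_D a b).2 (ex_intro _ _ (conj eD c0)).
    by have := (skew_D a.+1 b).2 (ex_intro _ _ (conj eD c1)); lia.
  by have [-> ->] := D_horiz eD; rewrite D_parity.
apply/idP/idP; first exact: DS.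
move=> dS; have cd : cov d d.1.1 d.1.2 by rewrite /cov inE -surjective_pairing eqxx.
have := in_strip_sub ld low_skew dS cd => /skew_D[e [eD ecd]].
by rewrite (in_strip_col_uniq ld low_skew dS (DS _ eD) cd ecd).
Qed.

Lemma hstrip_low : hstrip l (low_shape l T v).
Proof.
split; first exact: low_skew.
rewrite -/m => i; apply/negP => oi.
(* In a segment of odd length the last box has even distance from the start, so it is neither the
   left nor the right half of a horizontal domino. *)
have [|D1|[j jE D2]] := @D_inner i (strip_end l m i).-1; first by lia.
  by have := D_horiz D1; lia.
by have := D_horiz D2; have := D_parity D2; lia.
Qed.

Lemma ssdt_restr : ssdt (low_shape l T v) (restr T v).
Proof.
rewrite -/m; have rT d : d \in domf (restr T v) -> d \in domf T.
  by rewrite restr_dom => /andP[].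
split.
- by move=> d i j; rewrite restr_dom => /andP[dT dv] dij; apply/lt_low; exists d.
- by move=> i j /lt_low[d [dT dij dv]]; exists d; rewrite restr_dom dT.
- by move=> d e i j /rT dT /rT eT; exact: (ssdt_uniq sT).
- by move=> d e i j k dT eT; rewrite !restr_lab //; apply: (ssdt_row sT); exact: rT.
- by move=> d e i j k dT eT; rewrite !restr_lab //; apply: (ssdt_col sT); exact: rT.
- by move=> d dT; rewrite restr_lab //; apply: (ssdt_top sT); exact: rT.
Qed.

(** With label 0 alone, a second row would either repeat the label in the first column or make the
    corner domino vertical. *)
Lemma peel_top : v = 0 -> l 1 = 0.
Proof.
move=> v0; have lab0 d : d \in domf T -> lab T d = 0 by move=> /Tv; rewrite v0; lia.
have [//|l1] := posnP (l 1).
have [d [dT d1]] := ssdt_cover sT l1.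
have [|e [eT e0]] := @ssdt_cover _ _ sT 0 0; first by have := ld 0; lia.
have [de|de] := eqVneq e d.
  subst e; have := ssdt_top sT dT e0; rewrite lab0 //.
  by case: d d1 {dT eT} e0 => [[a b] []]; rewrite !covE /=; lia.
by have := ssdt_col sT eT dT de e0 d1; rewrite !lab0 //; lia.
Qed.

Lemma add_restr (E : {fset domino}) :
  (forall d, d \in E = in_strip l (low_shape l T v) d) -> add_strip (restr T v) E v = T.
Proof.
move=> EE; have {}EE d : d \in E = (d \in domf T) && (lab T d == v).
  by rewrite EE strip_low.
have dE : domf (add_strip (restr T v) E v) = domf T.
  apply/fsetP => d; rewrite domf_add inE EE restr_dom -andb_orr.
  by case dT : (d \in domf T) => //=; rewrite orbC -leq_eqVlt; apply: Tv.
apply: (lab_ext dE) => d; rewrite dE lab_add EE => dT; rewrite dT /=.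
case: eqP => [-> //|/eqP dv]; apply: restr_lab.
by rewrite restr_dom dT /=; have := Tv dT; lia.
Qed.

End Peel.

(** * Shapes and 2-quotients *)

(* The shape with 2-quotient ((p), (q)) for None, ((p + 1, 1), (q)) for
   Some false and ((p), (q + 1, 1)) for Some true. *)
Definition code : Type := (option bool * nat * nat)%type.

Definition qshape (x : code) : seq nat :=
  let: (k, p, q) := x in
  match k with
  | None => if q <= p then [:: 2 * p; 2 * q; 0; 0]
            else [:: 2 * q - 1; 2 * p + 1; 0; 0]
  | Some false => if q == 0 then [:: 2 * p + 2; 1; 1; 0]
                  else if q <= p.+1 then [:: 2 * p + 2; 2 * q; 2; 0]
                  else [:: 2 * q - 1; 2 * p + 3; 2; 0]
  | Some true => if q < p then [:: 2 * p; 2 * q + 2; 1; 1]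
                 else [:: 2 * q + 1; 2 * p + 1; 1; 1]
  end.

Lemma qshape4 x : exists a b c d, qshape x = [:: a; b; c; d].
Proof.
case: x => [[[[]|] p] q] /=; do ?[case: ifP => _];
  by do 4 eexists; reflexivity.
Qed.

Lemma qshape_inj : injective qshape.
Proof.
case=> [[[[]|] p] q] [[[[]|] p'] q'] /=;
  do ?[case: ifP => ?]; move=> [] *; try (by exfalso; lia);
  by do ?[congr (_, _)]; lia.
Qed.

Lemma qshape_decreasing x : weakly_decreasing (nth 0 (qshape x)).
Proof.
move=> i; case: x => [[[[]|] p] q] /=; do ?[case: ifP => ?];
  do 5 (case: i => [|i] /=; rewrite ?nth_nil; try lia).
Qed.

(* The codes whose shape is obtained by removing a horizontal strip of c
   dominoes, d of them from the second component of the quotient. *)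
Definition step (c d : nat) (x : code) : seq code :=
  let: (k, p, q) := x in let t := c - d in
  match k with
  | None => if (d <= q) && (t <= p) then [:: (None, p - t, q - d)] else [::]
  | Some false =>
      if d <= q then
        (if t <= p then [:: (Some false, p - t, q - d)] else [::])
        ++ (if 0 < t <= p.+1 then [:: (None, p + 2 - t, q - d)] else [::])
      else [::]
  | Some true =>
      if t <= p then
        (if d <= q then [:: (Some true, p - t, q - d)] else [::])
        ++ (if 0 < d <= q.+1 then [:: (None, p - t, q + 2 - d)] else [::])
      else [::]
  end.

(** [z] marks the label 0, which requires a one-row shape; these are the shapes of the codes
    [(None, p, 0)]. *)
Definition preds (z : bool) (c : nat) (x : code) : seq code :=
  if z && ((x.1.1 != None) || (x.2 != 0)) then [::]
  else flatten [seq step c d x | d <- iota 0 c.+1].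

(** Additive form of the interlacing conditions on the two components. When a hook loses its lower
    box, the removal is nonempty and so is the remaining row. *)
Lemma mem_step c d k p q k' p' q' :
  ((k', p', q') \in step c d (k, p, q)) =
  match k, k' with
  | None, None | Some false, Some false | Some true, Some true =>
      (p == p' + (c - d)) && (q == q' + d)
  | Some false, None => [&& 0 < p', 0 < c - d, p + 2 == p' + (c - d) & q == q' + d]
  | Some true, None => [&& 0 < q', 0 < d, p == p' + (c - d) & q + 2 == q' + d]
  | _, _ => false
  end.
Proof.
rewrite /step; case: k => [[]|]; case: k' => [[]|];
  do ?[case: ifP => ? /=]; rewrite ?inE ?xpair_eqE //=; lia.
Qed.

Lemma preds_uniq z c x : uniq (preds z c x).
Proof.
rewrite /preds; case: ifP => // _.
have -> : flatten [seq step c d x | d <- iota 0 c.+1] =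
  [seq y | d <- iota 0 c.+1, y <- step c d x] by congr flatten; apply: eq_map => d; rewrite map_id.
apply: allpairs_uniq_dep; first exact: iota_uniq.
  move=> d _; case: x => [[[[]|] p] q] /=; do ?[case: ifP => ? //=].
move=> [d y] [d' y'] /allpairsPdep[e [z0 [_ ez e2]]] /allpairsPdep[e' [z' [_ ez' e2']]] /= yy.
case: e2 e2' ez ez' => <- <- [] <- <-; rewrite -yy {y' yy}.
by case: x y => [[k p] q] [[k' p'] q']; rewrite !mem_step;
  case: k k' => [[]|] [[]|] //=; move=> ? ?; have -> : d = d' by lia.
Qed.

Lemma hstrip4 a b c d a' b' c' d' :
  hstrip (nth 0 [:: a; b; c; d]) (nth 0 [:: a'; b'; c'; d']) <->
  [&& a' <= a, b' <= b, c' <= c, d' <= d, c <= a', d <= b', b' <= a', c' <= b', d' <= c',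
      ~~ odd (a - maxn a' b), ~~ odd (minn b a' - maxn b' c),
      ~~ odd (minn c b' - maxn c' d) & ~~ odd (minn d c' - d')].
Proof.
split=> [[ss pp]|].
  have [h1 h2 h3] := ss 0; have [h4 h5 h6] := ss 1; have [h7 _ h8] := ss 2; have [h9 _ _] := ss 3.
  have := pp 0; have := pp 1; have := pp 2; have := pp 3.
  rewrite /strip_start /strip_end /= maxn0 => -> -> -> ->.
  by rewrite h1 h2 h3 h4 h5 h6 h7 h8 h9.
do 12![case/andP=> ?] => ?; split=> i.
  by do 4 (case: i => [|i]; first by split).
do 4 (case: i => [|i]; first by rewrite /strip_start /= ?maxn0).
have := strip_end_le (nth 0 [:: a; b; c; d]) (nth 0 [:: a'; b'; c'; d']) i.+4.
by rewrite nth_default // leqn0 => /eqP ->.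
Qed.

Lemma preds_hstrip z c x y : y \in preds z c x ->
  [/\ hstrip (nth 0 (qshape x)) (nth 0 (qshape y)), z -> nth 0 (qshape x) 1 = 0
    & sumn (qshape x) = sumn (qshape y) + 2 * c].
Proof.
rewrite /preds; case: ifP => // zx /flatten_mapP[d]; rewrite mem_iota add0n => /andP[_ dc].
move: x y zx => [[k p] q] [[k' p'] q'] /= zx; rewrite mem_step.
have [t ct] : exists t, c = t + d by exists (c - d); lia.
rewrite ct addnK {c dc ct} => H.
split; move: H zx.
- by case: k k' => [[]|] [[]|] //= H _; do ?[case: ifP => ? /=]; apply/hstrip4;
    do ?[apply/andP; split]; lia.
- by case: k k' => [[]|] [[]|] //=; do ?[case: ifP => ? /=]; lia.
- by case: k k' => [[]|] [[]|] //=; do ?[case: ifP => ? /=]; lia.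
Qed.

Lemma mem_preds (z : bool) c d x y : d <= c -> y \in step c d x ->
  (z -> x.1.1 = None /\ x.2 = 0) -> y \in preds z c x.
Proof.
move=> dc yd zx; rewrite /preds; case: ifP.
  by case/andP=> /zx[-> ->].
by move=> _; apply/flatten_mapP; exists d; rewrite // mem_iota.
Qed.

Lemma parity_split a : exists a1, a = 2 * a1 \/ a = (2 * a1).+1.
Proof. exists a./2; lia. Qed.

Lemma eq_seq4 (T : Type) (a b c d a' b' c' d' : T) :
  a = a' -> b = b' -> c = c' -> d = d' -> [:: a; b; c; d] = [:: a'; b'; c'; d'].
Proof. by move=> -> -> -> ->. Qed.

(** Converse of [preds_hstrip]: the even segment lengths restrict the parities of the rows of [mu]
    so far that [mu] is again the shape of a code. *)
Lemma hstrip_preds (z : bool) c x a b c' d' (mu := [:: a; b; c'; d']) :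
  hstrip (nth 0 (qshape x)) (nth 0 mu) -> (z -> nth 0 (qshape x) 1 = 0) ->
  sumn (qshape x) = sumn mu + 2 * c -> exists2 y, y \in preds z c x & qshape y = mu.
Proof.
case: x => [[k p] q]; rewrite /mu {mu} => H Hz Hs.
suff [y [d [dc yd zx sy]]] : exists y d, [/\ d <= c, y \in step c d (k, p, q),
    z -> k = None /\ q = 0 & qshape y = [:: a; b; c'; d']].
  by exists y => //; apply: mem_preds dc yd zx.
have [l0 [l1 [l2 [l3 E]]]] := qshape4 (k, p, q).
move: H Hz Hs; rewrite E.
have [l2b l3b] : l2 <= 2 /\ l3 <= 1.
  by case: k E => [[]|] /=; do ?[case: ifP => _]; case=> _ _ <- <-.
case/hstrip4/and4P=> ha hb hc /andP[hd hrest].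
rewrite [nth _ _ _]/= [sumn _]/= [sumn [:: a; _; _; _]]/= !addn0 => Hz Hs.
have d0 : d' = 0 \/ d' = 1 by move: (leq_trans hd l3b); clear; lia.
have d1 : c' = 0 \/ c' = 1 \/ c' = 2 by move: (leq_trans hc l2b); clear; lia.
move: hrest; case/and4P=> h4 h5 h6; case/and3P=> h7 h8; case/and4P=> o0 o1 o2 o3.
(* Which of [l1] and [a] is larger decides where the segment of row 0 starts and that of row 1
   ends. *)
have {o0 o1} o01 : ~~ odd (l0 - a) /\ ~~ odd (l1 - maxn b l2) /\ l1 <= a \/
    ~~ odd (l0 - l1) /\ ~~ odd (a - maxn b l2) /\ a < l1.
  have [la|la] := leqP l1 a; [left|right].
    by rewrite -{1}(maxn_idPl la) -{2}(minn_idPl la).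
  by rewrite -{1}(maxn_idPr (ltnW la)) -{2}(minn_idPr (ltnW la)).
have [a1 ea] := parity_split a; have [b1 eb] := parity_split b.
case: ea => ea; case: eb => eb; (case: d0 => ?; [case: d1 => [?|[?|?]]|]); subst a b;
  subst; case: o01 => [[o0 [o1 la]]|[o0 [o1 la]]];
  try (exfalso; case: k E => [[]|] /=; do ?[case: ifP => ?]; case=> *; subst; lia).
7-8: have [b10|b10] := posnP b1;
  [|by exfalso; case: k E => [[]|] /=; do ?[case: ifP => ?]; case=> *; subst; lia].
9-10: have b10 : k = Some false -> 0 < b1 by move=> ek; subst k; move: E => /=;
  do ?[case: ifP => ?]; case=> *; subst; lia.
(* Two even leading rows come from [p] and then [q], two odd ones from [q] and then [p]; the last
   two rows give the kind of code. An even row followed by an odd one occurs only for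
   [[:: 2 * a1; 1; 1; 0]]. The second witness counts the dominoes lost by the second component. *)
1-2: exists (None, a1, b1), (if k == Some true then q + 2 - b1 else q - b1).
3-4: exists (Some false, a1 - 1, b1), (q - b1).
5-6: exists (Some true, a1, b1 - 1), (q - (b1 - 1)).
7-8: exists (Some false, a1 - 1, 0), (q - 0).
9-10: exists (None, b1, a1.+1), (if k == Some true then q + 2 - a1.+1 else q - a1.+1).
11-12: exists (Some false, b1 - 1, a1.+1), (q - a1.+1).
13-14: exists (Some true, b1, a1), (q - a1).
all: rewrite mem_step; try move: b10; case: k E => [[]|] /=; do ?[case: ifP => ?]; case=> *; subst;
  try (exfalso; lia); clear o0 o1 o2 o3; split.
all: match goal with
  | b : _ -> is_true (0 < _) |- is_true _ => try have := b erefl; lia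
  | |- is_true _ => lia
  | |- @eq (seq _) _ _ => apply: eq_seq4; lia
  | |- _ -> Some _ = _ /\ _ => move=> /Hz ?; exfalso; lia
  | |- _ => move=> /Hz ?; split; [by []|lia]
  end.
Qed.

(** * Enumeration of the tableaux *)

(** Both sides count the boxes of the diagram, two for each domino. *)
Lemma ssdt_card lam T : ssdt (nth 0 lam) T -> sumn lam = 2 * #|` domf T|.
Proof.
move=> sT.
pose s1 := [seq c | d <- enum_fset (domf T), c <- boxes d].
pose s2 := [seq (i, j) | i <- iota 0 (size lam), j <- iota 0 (nth 0 lam i)].
have /perm_size : perm_eq s1 s2.
  apply: uniq_perm.
  - apply: allpairs_uniq_dep; first exact: fset_uniq.
      by move=> [[a b] t] _; case: t; rewrite /boxes /= !inE xpair_eqE; lia.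
    move=> [d [i j]] [e [i' j']] /allpairsPdep[d' [c [dT cd [-> ->]]]].
    move=> /allpairsPdep[e' [c' [eT ce [-> ->]]]] /= cc; subst c'.
    by have -> : d' = e' by case: c cd ce => u w; exact: (ssdt_uniq sT dT eT).
  - apply: allpairs_uniq_dep; first exact: iota_uniq.
      by move=> i _; exact: iota_uniq.
    by move=> [i j] [i' j'] _ _ /= [-> ->].
  - case=> i j; apply/allpairsPdep/allpairsPdep => [[d [c [dT dc ec]]]|[i' [j' []]]].
      subst c; have ji := ssdt_sub sT dT dc; exists i, j; split=> //; rewrite mem_iota //= add0n.
      by case: ltnP => // /(nth_default 0) ni; rewrite ni in ji.
    rewrite !mem_iota !add0n /= => _ jl [-> ->].
    by have [d [dT dij]] := ssdt_cover sT jl; exists d, (i', j').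
have -> : size s1 = 2 * #|` domf T|.
  rewrite size_allpairs_dep; elim: (enum_fset _) => //= d s ->; rewrite mulnS; lia.
rewrite size_allpairs_dep => ->; congr sumn.
apply: (@eq_from_nth _ 0); rewrite ?size_map ?size_iota // => i il.
by rewrite (nth_map 0) ?size_iota // nth_iota // size_iota.
Qed.

Definition strip (l m : seq nat) : {fset domino} :=
  [fset d in [seq (c, t) | c <- [seq (i, j) | i <- iota 0 (size l), j <- iota 0 (nth 0 l 0)],
      t <- [:: true; false]] | in_strip (nth 0 l) (nth 0 m) d]%fset.

Lemma mem_strip l m d : weakly_decreasing (nth 0 l) ->
  (d \in strip l m) = in_strip (nth 0 l) (nth 0 m) d.
Proof.
move=> ld; rewrite in_fset inE; case: (boolP (in_strip _ _ _)) => [H|]; last by rewrite andbF.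
rewrite andbT; case: d H => [[i j] t] H.
have il : i < size l /\ j < nth 0 l 0.
  have : j < nth 0 l i.
    move: H; rewrite in_stripE; case: t; first by have := ld i; lia.
    by have := strip_end_le (nth 0 l) (nth 0 m) i; lia.
  have := weakly_decreasing_le ld (leq0n i).
  by case: (ltnP i (size l)) => [|/(nth_default 0) ->] //; lia.
apply/allpairsPdep; exists (i, j), t; split=> //; last by case: t {H}.
by apply/allpairsPdep; exists i, j; rewrite !mem_iota !add0n /= il.1 il.2.
Qed.

Definition nlab (T : {fmap domino -> nat}) (u : nat) : nat :=
  #|` [fset d in domf T | lab T d == u]%fset|.

Lemma in_nlab T u d :
  (d \in [fset d in domf T | lab T d == u]%fset) = (d \in domf T) && (lab T d == u).
Proof. by rewrite !inE. Qed.

(** Enumerates the tableaux with [c u] labels [u] for each [u < v] and no others, adding the strip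
    of the largest label last. *)
Fixpoint tableaux (c : nat -> nat) (v : nat) (x : code) : seq {fmap domino -> nat} :=
  if v is v'.+1 then
    [seq add_strip T (strip (qshape x) (qshape y)) v' |
      y <- preds (v' == 0) (c v') x, T <- tableaux c v' y]
  else if x == (None, 0, 0) then [:: fmap0] else [::].

Lemma tableauxS c v x : tableaux c v.+1 x =
  [seq add_strip T (strip (qshape x) (qshape y)) v | y <- preds (v == 0) (c v) x, T <- tableaux c v y].
Proof. by []. Qed.

Definition bounded_content (c : nat -> nat) (v : nat) (T : {fmap domino -> nat}) :=
  (forall d, d \in domf T -> lab T d < v) /\ forall u, u < v -> nlab T u = c u.

Lemma tableaux_sound c v x T : T \in tableaux c v x ->
  ssdt (nth 0 (qshape x)) T /\ bounded_content c v T.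
Proof.
elim: v x T => [|v IH] x T.
  rewrite /tableaux; case: eqP => [->|//]; rewrite inE => /eqP ->.
  split; last by split.
  split=> [d i j|i j|d e i j|d e i j k|d e i j k|d]; rewrite ?in_fset0 //.
  by do 4 (case: i => [|i] //); rewrite nth_default.
rewrite tableauxS => /allpairsPdep[y [U [yx Uy ->]]].
have [sU [Ub Uc]] := IH _ _ Uy.
have [hs zx ss] := preds_hstrip yx.
have ld := qshape_decreasing x.
move: (strip _ _) (fun d => mem_strip (qshape y) d ld) => S SE.
have sT : ssdt (nth 0 (qshape x)) (add_strip U S v).
  by apply: ssdt_add sU Ub SE => // /eqP.
split=> //; split=> [d|u].
  by rewrite domf_add lab_add inE => /orP[/Ub|->] //; case: ifP => // _; lia.
have disj : (domf U `&` S)%fset = fset0.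
  apply/fsetP => d; rewrite !inE; apply/negP => /andP[dU]; rewrite SE => dS.
  have cd : cov d d.1.1 d.1.2 by rewrite /cov inE -surjective_pairing eqxx.
  by have := ssdt_sub sU dU cd; have := in_strip_sub ld hs.1 dS cd; lia.
rewrite ltnS leq_eqVlt => /orP[/eqP ->|uv].
  (* Comparing the areas of the two shapes gives the number of dominoes labelled [v]. *)
  have := ssdt_card sT; have := ssdt_card sU; rewrite domf_add cardfsU disj cardfs0.
  suff -> : nlab (add_strip U S v) v = #|` S|.
    by move: ss; lia.
  congr #|` _|; apply/fsetP => d; rewrite in_nlab domf_add lab_add in_fsetU.
  case: ifP => dS; rewrite ?orbT ?eqxx // orbF; apply/negP => /andP[/Ub]; lia.
rewrite -(Uc u uv); congr #|` _|; apply/fsetP => d; rewrite !in_nlab domf_add lab_add in_fsetU.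
case: ifP => dS; last by rewrite orbF.
rewrite orbT /=; have /fsetP/(_ d) := disj; rewrite in_fsetI in_fset0 dS andbT => ->; lia.
Qed.

Lemma tableaux_complete c v x T : ssdt (nth 0 (qshape x)) T -> bounded_content c v T ->
  T \in tableaux c v x.
Proof.
elim: v x T => [|v IH] x T sT [Tb Tc].
  have T0 : domf T = fset0.
    by apply/fsetP => d; rewrite in_fset0; apply/negP => /Tb.
  have := ssdt_card sT; rewrite T0 cardfs0 /tableaux.
  case: eqP => [_ _|nx sx].
    by rewrite inE; apply/eqP/fmap_nil.
  by case: nx; case: x sx {sT} => [[[[]|] p] q] /=; do ?[case: ifP => ?];
    move=> /= *; do ?congr (_, _); lia.
have ld := qshape_decreasing x.
pose m := low_shape (nth 0 (qshape x)) T v.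
(* Shapes of codes have at most four rows, hence so does what remains below [v]. *)
pose mu := [:: m 0; m 1; m 2; m 3].
have mE : m = nth 0 mu.
  apply/funext => i; do 4 (case: i => [//|i]); rewrite [RHS]nth_default //.
  have [+ _ _] := (hstrip_low ld sT Tb).1 i.+4.
  rewrite [X in _ <= X]nth_default ?leqn0 => [/eqP //|].
  by have [a [b [c' [d ->]]]] := qshape4 x.
have hs : hstrip (nth 0 (qshape x)) (nth 0 mu) by rewrite -mE; exact: hstrip_low.
have sR : ssdt (nth 0 mu) (restr T v) by rewrite -mE; exact: ssdt_restr.
have SE d : (d \in domf T) && (lab T d == v) = in_strip (nth 0 (qshape x)) m d by exact: strip_low.
have [|y yx sy] := @hstrip_preds (v == 0) (c v) x _ _ _ _ hs (fun v0 => peel_top ld sT Tb (eqP v0)).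
  rewrite (ssdt_card sT) (ssdt_card sR) -(Tc v) // -mulnDr; congr (2 * _).
  rewrite /nlab -cardfsUI.
  have -> : (domf (restr T v) `&` [fset d in domf T | lab T d == v] = fset0)%fset.
    by apply/fsetP => d; rewrite in_fsetI in_nlab in_fset0 restr_dom; case: (d \in _) => //=; lia.
  rewrite cardfs0 addn0; congr #|` _|; apply/fsetP => d; rewrite in_fsetU in_nlab restr_dom.
  by case dT : (d \in domf T) => //=; rewrite orbC -leq_eqVlt -ltnS; rewrite Tb.
rewrite tableauxS; apply/allpairsPdep; exists y, (restr T v); split=> //.
  apply: IH; first by rewrite sy.
  split=> [d|u uv]; first by rewrite restr_dom => /andP[dT dv]; rewrite restr_lab // restr_dom dT.
  rewrite -(Tc u (leqW uv)) /nlab; congr #|` _|; apply/fsetP => d; rewrite !in_nlab.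
  case: (boolP (d \in domf (restr T v))) => [dR|].
    by rewrite restr_lab //; move: dR; rewrite restr_dom => /andP[->].
  by rewrite restr_dom; case: (d \in domf T) => //=; lia.
symmetry; apply: (add_restr ld sT Tb) => d.
by rewrite mem_strip // sy -/m mE.
Qed.

(** Deleting the label [v] recovers the smaller tableau, whose boxes give its shape and, by
    [qshape_inj], its code. *)
Lemma tableaux_uniq c v x : uniq (tableaux c v x).
Proof.
elim: v x => [|v IH] x; first by rewrite /tableaux; case: ifP.
rewrite tableauxS; apply: allpairs_uniq_dep; first exact: preds_uniq.
  by move=> y _.
move=> [y U] [y' U'] /allpairsPdep[z [V [yx Uy [-> ->]]]].
move=> /allpairsPdep[z' [V' [yx' Uy' [-> ->]]]] /= E {y U y' U'}.
have [sV [Vb _]] := tableaux_sound Uy; have [sV' [Vb' _]] := tableaux_sound Uy'.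
have ld := qshape_decreasing x.
have restr_add w W : w \in preds (v == 0) (c v) x -> ssdt (nth 0 (qshape w)) W ->
    (forall d, d \in domf W -> lab W d < v) ->
    restr (add_strip W (strip (qshape x) (qshape w)) v) v = W.
  move=> wx sW Wb; have [hs _ _] := preds_hstrip wx.
  have WS d : d \in domf W -> (d \in strip (qshape x) (qshape w)) = false.
    move=> dW; apply/negP; rewrite mem_strip // => dS.
    have cd : cov d d.1.1 d.1.2 by rewrite /cov inE -surjective_pairing eqxx.
    by have := ssdt_sub sW dW cd; have := in_strip_sub ld hs.1 dS cd; lia.
  have dE : domf (restr (add_strip W (strip (qshape x) (qshape w)) v) v) = domf W.
    apply/fsetP => d; rewrite restr_dom domf_add lab_add inE.
    case: (boolP (d \in domf W)) => dW /=; first by rewrite WS // Wb.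
    by case: ifP => // _; rewrite ltnn.
  apply: (lab_ext dE) => d dR; rewrite restr_lab // lab_add WS //.
  by rewrite -dE.
have VV : V = V' by rewrite -(restr_add z V) // E restr_add.
subst V'; congr existT; apply: qshape_inj.
have [a [b [c' [d ez]]]] := qshape4 z; have [a' [b' [c'' [d' ez']]]] := qshape4 z'.
have sub (w w' : code) i : ssdt (nth 0 (qshape w)) V -> ssdt (nth 0 (qshape w')) V ->
    nth 0 (qshape w) i <= nth 0 (qshape w') i.
  move=> sw sw'; rewrite leqNgt; apply/negP => H.
  have [e [eV ce]] := ssdt_cover sw H.
  by have := ssdt_sub sw' eV ce; rewrite ltnn.
have eqi i : nth 0 (qshape z) i = nth 0 (qshape z') i.
  by apply/eqP; rewrite eqn_leq !sub.
rewrite ez ez' in eqi *.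
by have := eqi 0; have := eqi 1; have := eqi 2; have := eqi 3 => /= -> -> -> ->.
Qed.

(** * Coefficients of the domino functions *)

Lemma genfun_size (T : choiceType) (A : set T) (wt : T -> {mset nat}%mset) m (l : seq T) :
  uniq l -> (forall t, t \in l <-> A t /\ wt t = m) -> genfun A wt m = (size l)%:R%R.
Proof.
move=> ul lP; rewrite /genfun (@fsbigE _ _ _ _ _ l).
- rewrite big_seq_cond (eq_bigr (fun=> 1%R)); last first.
    by move=> t /andP[/lP[_ ->]]; rewrite eqxx.
  rewrite (eq_bigl (fun t => t \in l)).
    by rewrite -big_seq big_const_seq count_predT iter_addr_0.
  move=> t; case: (boolP (t \in l)) => //= /lP[At _].
  by apply/asboolP.
- exact: ul.
- by move=> t /lP[].
- move=> t At tl; case: eqP => // wm; case/negP: tl; exact/lP.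
Qed.

Lemma weight_count (T : {fmap domino -> nat}) u :
  seq_mset [seq T d | d : domf T] u = nlab T u.
Proof.
rewrite mset_seqE /nlab.
have -> : [seq T d | d : domf T] = [seq lab T d | d <- enum_fset (domf T)].
  by rewrite enum_fsetE -map_comp; apply: eq_map => d /=; rewrite lab_val.
rewrite count_map -size_filter; apply/perm_size/uniq_perm.
- by rewrite filter_uniq ?fset_uniq.
- exact: fset_uniq.
- by move=> d; rewrite mem_filter in_nlab andbC.
Qed.

Lemma SSDT_weight (m : {mset nat}%mset) v T : (forall u, v <= u -> m u = 0) ->
  seq_mset [seq T d | d : domf T] = m <-> bounded_content m v T.
Proof.
move=> mv; split=> [wm|[Tb Tc]].
  split=> [d dT|u uv]; last by rewrite -weight_count wm.
  rewrite ltnNge; apply/negP => /mv; rewrite -wm weight_count => /eqP.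
  by rewrite cardfs_eq0 => /eqP/fsetP/(_ d); rewrite in_nlab dT eqxx in_fset0.
apply/msetP => u; rewrite weight_count; have [/Tc //|vu] := ltnP u v.
rewrite mv //; apply/eqP; rewrite cardfs_eq0; apply/eqP/fsetP => d.
by rewrite in_nlab in_fset0; apply/negP => /andP[/Tb]; lia.
Qed.

Lemma domfun_tableaux lam x (m : {mset nat}%mset) v : is_partition lam ->
  nth 0 lam =1 nth 0 (qshape x) -> (forall u, v <= u -> m u = 0) ->
  domfun lam m = (size (tableaux m v x))%:R%R.
Proof.
move=> pl lx mv; rewrite /domfun pl; apply: genfun_size; first exact: tableaux_uniq.
move=> T; have /funext lx' := lx; split=> [/tableaux_sound[sT bT]|[/SSDT_ssdt sT wT]].
  by split; [apply/SSDT_ssdt; rewrite lx'|apply/(SSDT_weight _ mv)].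
by apply: tableaux_complete; [rewrite -lx'|apply/(SSDT_weight _ mv)].
Qed.

(** * Sign words *)

(* A word of signs (true for a negative entry) that is weakly decreasing on each
   block, with its numbers of nonempty positive and negative pieces. *)
Definition word : Type := (seq bool * nat * nat)%type.

Definition wext (c d : nat) (w : word) : word :=
  let: (s, P, M) := w in
  (s ++ nseq d true ++ nseq (c - d) false, P + (d < c), M + (0 < d)).

Fixpoint words (c : nat -> nat) (v : nat) : seq word :=
  if v is v'.+1 then
    [seq wext (c v') d w | w <- words c v', d <- iota 0 (if v' == 0 then 1 else (c v').+1)]
  else [:: ([::], 0, 0)].

Lemma wordsS c v : words c v.+1 =
  [seq wext (c v) d w | w <- words c v, d <- iota 0 (if v == 0 then 1 else (c v).+1)].
Proof. by []. Qed.

Definition npos (w : word) := count negb w.1.1.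
Definition nneg (w : word) := count id w.1.1.

(** A sign that occurs has a piece, and pieces are nonempty. These bounds control the truncated
    differences [P - 1] and [M - 1]. *)
Definition wf_word (w : word) :=
  ((0 < npos w) <= w.1.2 <= npos w) && ((0 < nneg w) <= w.2 <= nneg w).

Lemma npos_ext c d w : d <= c -> npos (wext c d w) = npos w + (c - d).
Proof.
case: w => [[s P] M] dc; rewrite /npos /= !count_cat !count_nseq /=; lia.
Qed.

Lemma nneg_ext c d w : d <= c -> nneg (wext c d w) = nneg w + d.
Proof.
case: w => [[s P] M] dc; rewrite /nneg /= !count_cat !count_nseq /=; lia.
Qed.

Lemma wf_ext c d w : d <= c -> wf_word w -> wf_word (wext c d w).
Proof.
move=> dc; rewrite /wf_word npos_ext // nneg_ext //.
by case: w => [[s P] M] /=; lia.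
Qed.

Lemma words_wf c v w : w \in words c v -> wf_word w.
Proof.
elim: v w => [|v IH] w; first by rewrite inE => /eqP ->.
rewrite wordsS => /allpairsPdep[w' [d [/IH w'wf]]]; rewrite mem_iota add0n => /andP[_ dc] ->.
by apply: wf_ext w'wf; case: eqP dc; lia.
Qed.

(* Contribution of a word to the number of tableaux of shape qshape x. *)
Definition contrib (x : code) (w : word) : nat :=
  let: (k, p, q) := x in
  match k with
  | None => (npos w == p) && (nneg w == q)
  | Some false => ((npos w == p + 2) && (nneg w == q)) * (w.1.2 - 1)
  | Some true => ((npos w == p) && (nneg w == q + 2)) * (w.2 - 1)
  end.

(** Appending a block mirrors removing a strip. [P - 1] grows by one exactly when the block has a
    positive entry and the word already had one; this is the extra predecessor in which the first
    component loses its lower box. The same holds for [M - 1] and the second component. *)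
Lemma step_contrib c d x w : d <= c -> wf_word w ->
  \sum_(y <- step c d x) contrib y w = contrib x (wext c d w).
Proof.
case: x => [[k p] q] dc; rewrite /contrib npos_ext // nneg_ext //.
case: w => [[s P] M]; rewrite /wf_word /wext /=.
move: (npos _) (nneg _) => pos neg wf.
case: k => [[]|]; do ?[case: ifP => ? /=]; rewrite ?big_cat ?big_seq1 ?big_nil /= ?big_cons ?big_nil /=;
  do ?[case: eqP => ? /=]; lia.
Qed.

Lemma size_tableaux c v x : size (tableaux c v x) = \sum_(w <- words c v) contrib x w.
Proof.
elim: v x => [|v IH] x.
  rewrite /= big_seq1; case: x => [[k p] q] /=.
  by case: eqP => [[-> -> ->]//|ne]; case: k ne => [[]|] ne; rewrite /= ?muln0 //;
    case: eqP => //= ep; case: eqP => //= eq; case: ne; rewrite -ep -eq.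
rewrite tableauxS size_allpairs_dep sumnE big_map.
under eq_bigr do rewrite IH.
(* At label 0 the word is at most one positive run, so [P <= 1] and every shape with a second row
   gets 0. *)
have [v0|v0] := posnP v.
  subst v; rewrite [words c 1]/= big_seq1 /preds andTb; case: ifP => [|/negbT].
    rewrite big_nil; case: x => [[[[]|] p] q] /=; rewrite ?npos_ext // /npos /nneg /=;
      rewrite ?count_nseq ?subn0 /=; lia.
  rewrite negb_or !negbK => /andP[/eqP xk /eqP xq]; rewrite big_flatten big_map.
  case: x xk xq => [[k p] q] /= -> -> .
  rewrite big_cons [X in _ + X]big1_seq ?addn0 => [|d]; last first.
    by rewrite mem_iota /= => d0; rewrite leqn0 ifF ?big_nil //; lia.
  rewrite /= /npos /nneg /= subn0 !count_nseq.
  case: ifP => H; rewrite ?big_seq1 ?big_nil /= ?big_seq1 /npos /nneg /=; lia.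
rewrite wordsS big_allpairs_dep (gtn_eqF v0) /preds andFb big_flatten big_map.
under eq_bigr do rewrite exchange_big.
rewrite exchange_big big_seq [RHS]big_seq; apply: eq_bigr => w /words_wf ww.
rewrite big_seq [RHS]big_seq; apply: eq_bigr => d; rewrite mem_iota add0n ltnS => /andP[_ dc].
exact: step_contrib.
Qed.

(** Index 0 of the [Some] families gives the shapes [(2n - 2, 1, 1)] and [(2n - 3, 1, 1, 1)]; the
    last family is repeated for the coefficient 2. *)
Definition codes (n : nat) : seq code :=
  [:: (None, n, 0); (None, 0, n)]
  ++ [seq (Some false, n - 2 - q, q) | q <- iota 0 (n - 1)]
  ++ [seq (Some true, p, n - 2 - p) | p <- iota 0 (n - 1)]
  ++ [seq (None, n - q, q) | q <- iota 1 (n - 1)]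
  ++ [seq (None, n - q, q) | q <- iota 1 (n - 1)].

Lemma sum_iota_pick a k j f : (forall q, q != j -> f q = 0) ->
  \sum_(q <- iota a k) f q = if a <= j < a + k then f j else 0.
Proof.
move=> f0; case: ifP => [jk|/negbT jk].
  rewrite (bigD1_seq j) ?iota_uniq ?mem_iota //= big1 ?addn0 //.
rewrite big1_seq // => q /= qa; apply: f0; apply: contraNneq jk => <-.
by rewrite mem_iota in qa.
Qed.

(** Each family has at most one index matching the numbers of signs. If both signs occur the total
    is [2 + (P - 1) + (M - 1)]; if only positive ones occur it is [1 + (P - 1)], and symmetrically.
    A sign that occurs once has one piece, so its absent term would be 0. *)
Lemma sum_contrib n w : 0 < n -> wf_word w ->
  \sum_(x <- codes n) contrib x w = if npos w + nneg w == n then w.1.2 + w.2 else 0.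
Proof.
move=> n0; rewrite /codes !big_cat /= !big_map big_cons big_seq1.
rewrite (sum_iota_pick _ _ (j := nneg w)); last by move=> q; rewrite /contrib; case: eqP => //; lia.
rewrite (sum_iota_pick _ _ (j := npos w)); last by move=> q; rewrite /contrib; case: eqP => //; lia.
rewrite (sum_iota_pick _ _ (j := nneg w)); last by move=> q; rewrite /contrib; case: eqP => //; lia.
rewrite /contrib /wf_word; move: (npos w) (nneg w) (w.1.2) w.2 => p q P M.
rewrite !mulnbl -!if_and => wf.
case/andP: wf => wP wM.
case: (eqVneq (p + q) n) => [pqn|pqn].
  subst n; have -> : (p == p + q - 2 - q + 2) && (q == q) = (1 < p) by lia.
  have -> : (p == p) && (q == p + q - 2 - p + 2) = (1 < q) by lia.
  have -> : (p == p + q - q) && (q == q) by lia.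
  have -> : (0 <= q < 0 + (p + q - 1)) = (1 < p) by lia.
  have -> : (0 <= p < 0 + (p + q - 1)) = (1 < q) by lia.
  have -> : (0 < q < 1 + (p + q - 1)) = (0 < p) && (0 < q) by lia.
  have -> : (p == p + q) && (q == 0) = (q == 0) by lia.
  have -> : (p == 0) && (q == p + q) = (p == 0) by lia.
  case: (ltngtP p 1) => p1; case: (ltngtP q 1) => q1; rewrite /=; lia.
have -> : (0 <= q < 0 + (n - 1)) && ((p == n - 2 - q + 2) && (q == q)) = false by lia.
have -> : [&& 0 <= p < 0 + (n - 1), p == p & q == n - 2 - p + 2] = false by lia.
have -> : [&& 0 < q < 1 + (n - 1), p == n - q & q == q] = false by lia.
lia.
Qed.

Lemma domfun_code lam k x (m : {mset nat}%mset) v : qshape x = lam ++ nseq k 0 ->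
  is_partition lam -> (forall u, v <= u -> m u = 0) ->
  domfun lam m = (size (tableaux m v x))%:R%R.
Proof.
move=> xlam pl mv; apply: domfun_tableaux => // i; rewrite xlam nth_cat nth_nseq if_same.
by case: ltnP => // /(nth_default 0).
Qed.

Definition shapes (n : nat) : seq (seq nat) :=
  [:: [:: 2 * n]; [:: 2 * n - 1; 1]; [:: 2 * n - 2; 1; 1]; [:: 2 * n - 3; 1; 1; 1]]
  ++ [seq [:: a; 2 * n - a] | a <- index_iota 0 (2 * n).+1 & 2 <= 2 * n - a <= a]
  ++ [seq [:: a; 2 * n - a] | a <- index_iota 0 (2 * n).+1 & 2 <= 2 * n - a <= a]
  ++ [seq [:: a; 2 * n - a - 2; 2] | a <- index_iota 0 (2 * n).+1 & 2 <= 2 * n - a - 2 <= a]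
  ++ [seq [:: a; 2 * n - a - 2; 1; 1] | a <- index_iota 0 (2 * n).+1 & 2 <= 2 * n - a - 2 <= a].

Lemma sum_shapes n :
  (\sum_(lam <- shapes n) domfun lam =
    domfun [:: (2 * n)%N] + domfun [:: (2 * n - 1)%N; 1%N]
    + domfun [:: (2 * n - 2)%N; 1%N; 1%N] + domfun [:: (2 * n - 3)%N; 1%N; 1%N; 1%N]
    + (\sum_(0 <= a < (2 * n).+1 | (2 <= 2 * n - a <= a)%N) domfun [:: a; (2 * n - a)%N]) *+ 2
    + \sum_(0 <= a < (2 * n).+1 | (2 <= 2 * n - a - 2 <= a)%N)
        domfun [:: a; (2 * n - a - 2)%N; 2%N]
    + \sum_(0 <= a < (2 * n).+1 | (2 <= 2 * n - a - 2 <= a)%N)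
        domfun [:: a; (2 * n - a - 2)%N; 1%N; 1%N])%R.
Proof.
rewrite /shapes !big_cat !big_map !big_filter !big_cons big_nil /=.
by rewrite mulr2n !addrA addr0.
Qed.

Lemma domfun0 lam m : ~~ is_partition lam -> domfun lam m = 0%R.
Proof. by rewrite /domfun => /negPf ->. Qed.

Ltac partition_tac := rewrite /is_partition /= /geq ?inE /=; lia.
Ltac qshape_tac := rewrite /=; do ?[case: ifP => ?]; apply: eq_seq4; lia.

Lemma domfun_shapes n (m : {mset nat}%mset) v : 0 < n -> (forall u, v <= u -> m u = 0) ->
  (\sum_(lam <- shapes n) domfun lam m = (\sum_(x <- codes n) size (tableaux m v x))%N%:R)%R.
Proof.
move=> n0 mv; pose sz (x : code) : int := (size (tableaux m v x))%:R%R.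
(* Passes from a sum over first rows [a] to one over the code parameter; [h] gives the first row of
   the shape. *)
have reindex f g (P : pred nat) (h : nat -> nat) k N :
    {in iota 1 k &, injective h} ->
    (forall a, (a < N) && P a <-> exists2 q, 0 < q <= k & a = h q) ->
    (forall q, 0 < q <= k -> f (h q) = g q) ->
    (\sum_(a <- [seq a <- index_iota 0 N | P a]) f a = \sum_(q <- iota 1 k) g q :> int)%R.
  move=> hi Ph fg; rewrite (perm_big [seq h q | q <- iota 1 k]) /=; last first.
    apply: uniq_perm; first by rewrite filter_uniq ?iota_uniq.
      by rewrite map_inj_in_uniq ?iota_uniq.
    move=> a; rewrite mem_filter mem_index_iota /=; apply/idP/mapP.
      by rewrite andbC => /Ph[q qk ->]; exists q => //; rewrite mem_iota; lia.
    case=> q; rewrite mem_iota => qk ->.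
    have /Ph : exists2 q', 0 < q' <= k & h q = h q' by exists q => //; lia.
    by rewrite andbC.
  rewrite big_map big_seq [RHS]big_seq; apply: eq_bigr => q; rewrite mem_iota => qk.
  by apply: fg; lia.
have two : (\sum_(a <- [seq a <- index_iota 0 (2 * n).+1 | (2 <= 2 * n - a <= a)%N])
    domfun [:: a; (2 * n - a)%N] m = \sum_(q <- iota 1 (n - 1)) sz (None, n - q, q)%N)%R.
  apply: (reindex _ _ _ (fun q => if q <= n - q then 2 * (n - q) else 2 * q - 1)).
  - by move=> q q'; rewrite !mem_iota; do ![case: ifP => ?]; lia.
  - move=> a /=; split=> [H|[q qn ->]]; last by case: ifP; lia.
    (* The parity of the first row tells which branch of [qshape] produced it. *)
    case: (boolP (odd a)) => oa; [exists (a.+1./2)|exists (n - a./2)]; try lia; by case: ifP; lia.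
  - move=> q qn; case: ifP => ?; (apply: (@domfun_code _ 2) => //; [qshape_tac|partition_tac]).
have three : (\sum_(a <- [seq a <- index_iota 0 (2 * n).+1 | (2 <= 2 * n - a - 2 <= a)%N])
    domfun [:: a; (2 * n - a - 2)%N; 2%N] m =
    \sum_(q <- iota 1 (n - 2)) sz (Some false, n - 2 - q, q)%N)%R.
  apply: (reindex _ _ _ (fun q => if q <= (n - 2 - q).+1 then 2 * (n - 2 - q) + 2 else 2 * q - 1)).
  - by move=> q q'; rewrite !mem_iota; do ![case: ifP => ?]; lia.
  - move=> a /=; split=> [H|[q qn ->]]; last by case: ifP; lia.
    case: (boolP (odd a)) => oa; [exists (a.+1./2)|exists (n - 1 - a./2)]; try lia; by case: ifP; lia.
  - move=> q qn; case: ifP => ?; (apply: (@domfun_code _ 1) => //; [qshape_tac|partition_tac]).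
have four : (\sum_(a <- [seq a <- index_iota 0 (2 * n).+1 | (2 <= 2 * n - a - 2 <= a)%N])
    domfun [:: a; (2 * n - a - 2)%N; 1%N; 1%N] m =
    \sum_(p <- iota 1 (n - 2)) sz (Some true, p, n - 2 - p)%N)%R.
  apply: (reindex _ _ _ (fun p => if n - 2 - p < p then 2 * p else 2 * (n - 2 - p) + 1)).
  - by move=> q q'; rewrite !mem_iota; do ![case: ifP => ?]; lia.
  - move=> a /=; split=> [H|[q qn ->]]; last by case: ifP; lia.
    case: (boolP (odd a)) => oa; [exists (n - 2 - a./2)|exists (a./2)]; try lia; by case: ifP; lia.
  - move=> q qn; case: ifP => ?; (apply: (@domfun_code _ 0) => //; [qshape_tac|partition_tac]).
rewrite natr_sum /shapes /codes !big_cat !big_map two three four /= !big_cons !big_nil !addr0.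
have -> : domfun [:: (2 * n)%N] m = sz (None, n, 0)%N.
  by apply: (@domfun_code _ 3 _ _ _ _ _ mv); [qshape_tac|partition_tac].
have -> : domfun [:: (2 * n - 1)%N; 1%N] m = sz (None, 0, n)%N.
  by apply: (@domfun_code _ 2 _ _ _ _ _ mv); [qshape_tac|partition_tac].
(* For [n = 1] the remaining two shapes start with 0, so they are not partitions, and the families
   are empty. *)
have [n1|n1] := leqP n 1.
  have -> : n = 1 by lia.
  by rewrite !domfun0 // subnn /= !big_nil !addr0.
have -> : domfun [:: (2 * n - 2)%N; 1%N; 1%N] m = sz (Some false, n - 2 - 0, 0)%N.
  by apply: (@domfun_code _ 1 _ _ _ _ _ mv); [qshape_tac|partition_tac].
have -> : domfun [:: (2 * n - 3)%N; 1%N; 1%N; 1%N] m = sz (Some true, 0, n - 2 - 0)%N.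
  by apply: (@domfun_code _ 0 _ _ _ _ _ mv); [qshape_tac|partition_tac].
have -> : iota 0 (n - 1) = 0 :: iota 1 (n - 2) by have -> : n - 1 = (n - 2).+1 by lia.
rewrite !big_cons /sz !subn0.
ring.
Qed.

(** The coefficients are the multiplicities in [L]; a member outside [P0 n] is no partition or has
    no tiling, and its domino function is 0. *)
Lemma G_positive_seq n (B : {set {perm 'I_(2 * n).+1}}) (L : seq (seq nat)) :
  {in L, forall lam, is_partition lam -> sumn lam = 2 * n} ->
  quasisym B = (\sum_(lam <- L) domfun lam)%R -> G_positive B.
Proof.
move=> LP QB; exists (fun lam => count_mem lam L); rewrite {}QB.
rewrite (@fsbigE _ _ _ _ _ [seq lam <- undup L | `[< P0 n lam >]]).
- rewrite big_filter_cond -[LHS]big_undup_iterop_count.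
  rewrite [RHS]big_mkcond; apply: eq_big_seq => lam; rewrite mem_undup => lamL.
  case: ifP => // /negbT lamP.
  have iter0 k : iterop k +%R (0 : series)%R 0%R = 0%R by rewrite -/(GRing.natmul _ _) mul0rn.
  suff -> : domfun lam = 0%R by exact: iter0.
  apply/funext => m.
  case: (boolP (is_partition lam)) => [pl|/domfun0 -> //].
  rewrite /domfun pl (@genfun_size _ _ _ _ [::]) // => T; split=> // -[[tT _ _ _] _].
  have lamP0 : P0 n lam by split=> //; [exact: LP|exists (domf T)].
  by case/negP: lamP; apply/andP; split; apply/asboolP.
- by rewrite filter_uniq ?undup_uniq.
- by move=> lam /=; rewrite mem_filter => /andP[/asboolP].
- move=> lam lamP; rewrite mem_filter mem_undup => /nandP[/asboolP //|lamS].
  by rewrite (count_memPn lamS) mulr0n.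
Qed.

Lemma sumn_shapes n : {in shapes n, forall lam, is_partition lam -> sumn lam = 2 * n}.
Proof.
move=> lam; rewrite /shapes !mem_cat !inE.
case/orP=> [/or4P[]/eqP-> |/or4P[]/mapP[a]];
  rewrite ?mem_filter ?mem_index_iota /is_partition /= ?inE; try lia.
all: by move=> ? ->; rewrite /=; lia.
Qed.

(** * The structure of signed arc permutations *)

Lemma rev_ord_val n (x : 'I_(2 * n).+1) : rev_ord x = 2 * n - x :> nat.
Proof. by rewrite /= subSS. Qed.

Lemma hyperoctP n (pi : {perm 'I_(2 * n).+1}) :
  reflect (forall x, pi (rev_ord x) = rev_ord (pi x)) (pi \in hyperoct n).
Proof. by rewrite inE; apply: (iffP forallP) => H x; apply/eqP. Qed.

Lemma pval_def n (pi : {perm 'I_(2 * n).+1}) i :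
  (pi (inord (n + i)) : nat)%:Z%R = (pval pi i + n%:Z)%R.
Proof. by rewrite /pval subrK. Qed.

Lemma hyperoct_center n (pi : {perm 'I_(2 * n).+1}) :
  pi \in hyperoct n -> pi (inord n) = inord n.
Proof.
move/hyperoctP/(_ (inord n)).
have -> : rev_ord (inord n) = inord n :> 'I_(2 * n).+1.
  by apply: ord_inj; rewrite rev_ord_val !inordK; lia.
by move/(congr1 (@nat_of_ord _)); rewrite rev_ord_val => e; apply: ord_inj; rewrite /= inordK; lia.
Qed.

Lemma pval0 n (pi : {perm 'I_(2 * n).+1}) : pi \in hyperoct n -> pval pi 0 = 0%R.
Proof. by move=> /hyperoct_center e; rewrite /pval addn0 e inordK ?subrr //; lia. Qed.

Lemma pval_abs n (pi : {perm 'I_(2 * n).+1}) i : pi \in hyperoct n -> 0 < i <= n ->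
  0 < `|pval pi i| <= n.
Proof.
move=> hpi ii; have := pval_def pi i; have := ltn_ord (pi (inord (n + i))).
suff : pval pi i <> 0%R by move: (pval _ _) (nat_of_ord _) => z k; lia.
move=> z0; have := pval_def pi i; rewrite z0 add0r => -[e].
have : pi (inord (n + i)) = pi (inord n).
  by rewrite hyperoct_center //; apply: ord_inj; rewrite /= e inordK; lia.
by move/perm_inj/(congr1 (@nat_of_ord _)); rewrite /= !inordK; lia.
Qed.

Lemma pval_abs_inj n (pi : {perm 'I_(2 * n).+1}) i j : pi \in hyperoct n ->
  0 < i <= n -> 0 < j <= n -> `|pval pi i| = `|pval pi j| -> i = j.
Proof.
move=> hpi ii jj e; have ei := pval_def pi i; have ej := pval_def pi j.
have [E|E] : pval pi i = pval pi j \/ pval pi i = (- pval pi j)%R.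
    by move: (pval _ _) (pval _ _) e => z z'; lia.
  have : pi (inord (n + i)) = pi (inord (n + j)) by apply: ord_inj; move: ei ej; rewrite E; lia.
  by move/perm_inj/(congr1 (@nat_of_ord _)); rewrite /= !inordK; lia.
have : pi (inord (n + i)) = pi (rev_ord (inord (n + j))).
  rewrite (hyperoctP _ hpi); apply: ord_inj; rewrite [RHS]rev_ord_val /=.
  have := ltn_ord (pi (inord (n + j))); move: ei ej; rewrite E; lia.
by move/perm_inj/(congr1 (@nat_of_ord _)); rewrite [RHS]rev_ord_val /= !inordK; lia.
Qed.

Lemma hyperoct_ext n (pi rho : {perm 'I_(2 * n).+1}) :
  pi \in hyperoct n -> rho \in hyperoct n ->
  (forall j, j < n -> pval pi j.+1 = pval rho j.+1) -> pi = rho.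
Proof.
move=> hp hr e; apply/permP => x.
have right i : 0 < i <= n -> pi (inord (n + i)) = rho (inord (n + i)).
  move=> ii; apply: ord_inj; have := pval_def pi i; have := pval_def rho i.
  by have := e i.-1; rewrite prednK; [move=> -> //; lia|lia].
have [xn|xn|xn] := ltngtP x n.
- have -> : x = rev_ord (inord (n + (n - x))).
    by apply: ord_inj; rewrite rev_ord_val /= inordK; lia.
  by rewrite (hyperoctP _ hp) (hyperoctP _ hr) right //; lia.
- have -> : x = inord (n + (x - n)).
    by apply: ord_inj; rewrite /= inordK; have := ltn_ord x; lia.
  by apply: right; have := ltn_ord x; lia.
- have -> : x = inord n by apply: ord_inj; rewrite /= inordK; lia.
  by rewrite !hyperoct_center.
Qed.

(* A signed arc permutation is encoded by its signs s (true for negative) and a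
   starting residue b: the positive entries are b + 1, b + 2, ... and the
   absolute values of the negative ones are b, b - 1, ... modulo n. *)
Definition offset (n : nat) (s : seq bool) (j : nat) : nat :=
  if nth false s j then n - 1 - count id (take j s) else count negb (take j s).

Definition aval (n : nat) (s : seq bool) (b j : nat) : nat := ((b + offset n s j) %% n).+1.

Definition arcval (n : nat) (s : seq bool) (b j : nat) : int :=
  if nth false s j then (- (aval n s b j)%:Z)%R else (aval n s b j)%:Z%R.

Lemma count_take s (j : nat) : j < size s ->
  count id (take j.+1 s) = count id (take j s) + nth false s j /\
  count negb (take j.+1 s) = count negb (take j s) + ~~ nth false s j.
Proof.
by move=> js; rewrite (take_nth false) // -cats1 !count_cat /= !addn0.
Qed.

Lemma count_negb (s : seq bool) : count id s + count negb s = size s.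
Proof. by rewrite -(count_predC id s). Qed.

(** Each entry extends one of two runs: positive entries take the offsets 0, 1, ... and negative
    ones [n - 1], [n - 2], ... *)
Lemma offset_prefix n s k x : size s = n -> k <= n ->
  (exists2 j, j < k & offset n s j = x) <->
  x < k - count id (take k s) \/ n - count id (take k s) <= x < n.
Proof.
move=> sn; elim: k => [|k IH] kn.
  by rewrite take0 /=; split=> [[j]//|]; lia.
have [e1 e2] := @count_take s k ltac:(lia).
have ck := count_negb (take k s); rewrite size_takel in ck; last by lia.
have {IH} [IH1 IH2] := IH (ltnW kn).
have ok : offset n s k = if nth false s k then n - 1 - count id (take k s) else k - count id (take k s).
  by rewrite /offset; case: ifP => // _; lia.
split.
  case=> j; rewrite ltnS leq_eqVlt => /orP[/eqP -> <-|jk jx].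
    by rewrite ok e1; case: (nth _ _ _); lia.
  have := IH1 (ex_intro2 _ _ j jk jx); rewrite e1; case: (nth _ _ _); lia.
rewrite e1 => H; have [->|xk] := eqVneq x (offset n s k); first by exists k.
have [|j jk jx] := IH2; last by exists j => //; lia.
by move: xk; rewrite ok; case: (nth _ _ _) H; lia.
Qed.

Lemma offset_lt n s j : size s = n -> j < n -> offset n s j < n.
Proof.
move=> sn jn; have := (@offset_prefix n s n (offset n s j) sn (leqnn _)).1.
by move=> /(_ (ex_intro2 _ _ j jn erefl)); lia.
Qed.

Lemma offset_inj n s j k : size s = n -> j < n -> k < n -> offset n s j = offset n s k -> j = k.
Proof.
have wlog i i' : size s = n -> i < i' -> i' < n -> offset n s i <> offset n s i'.
  move=> sn ii in' e.
  have := (@offset_prefix n s i' (offset n s i') sn ltac:(lia)).1 (ex_intro2 _ _ i ii e).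
  have ck := count_negb (take i' s); rewrite size_takel in ck; last by lia.
  by rewrite /offset; case: (nth _ _ _); lia.
move=> sn jn kn e; have [jk|jk|//] := ltngtP j k; exfalso.
  exact: wlog jk kn e.
exact: wlog jk jn (esym e).
Qed.

Lemma eqmod_window n x y : x = y %[mod n] -> x <= y < x + n -> x = y.
Proof.
move=> /eqP; rewrite eq_sym => + /andP[xy yn]; rewrite eqn_mod_dvd //.
have [|d0 /dvdn_leq] := posnP (y - x); first by lia.
by move=> /(_ d0); lia.
Qed.

Lemma aval_mod n s b j : aval n s b j = b + 1 + offset n s j %[mod n].
Proof. by rewrite /aval -addn1 modnDml addnAC. Qed.

Lemma aval_bound n s b j : 0 < n -> 0 < aval n s b j <= n.
Proof. by move=> n0; rewrite /aval /= ltn_mod. Qed.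

Lemma eqmod_bound n x y : 0 < x <= n -> 0 < y <= n -> x = y %[mod n] -> x = y.
Proof.
move=> xn yn e; case: (leqP x y) => xy; first by apply: eqmod_window e _; lia.
by apply/esym/(eqmod_window (esym e)); lia.
Qed.

Lemma aval_inj n s b j k : size s = n -> j < n -> k < n ->
  aval n s b j = aval n s b k -> j = k.
Proof.
move=> sn jn kn /(congr1 (modn^~ n)); rewrite !aval_mod => /eqP.
rewrite eqn_modDl !modn_small ?offset_lt //.
by move/eqP; exact: offset_inj.
Qed.

Definition arc_data n (s : seq bool) (b : nat) (pi : {perm 'I_(2 * n).+1}) :=
  forall j, j < n -> pval pi j.+1 = arcval n s b j.

Lemma arc_abs n s b (pi : {perm 'I_(2 * n).+1}) j : arc_data s b pi -> j < n ->
  `|pval pi j.+1| = aval n s b j.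
Proof. by move=> d /d ->; rewrite /arcval; case: ifP => _; lia. Qed.

Lemma arc_data_exists n s b : size s = n ->
  exists2 pi : {perm 'I_(2 * n).+1}, pi \in hyperoct n & arc_data s b pi.
Proof.
move=> sn.
(* [h] is the odd extension of the prescribed values; [f] below transports it to ordinals. *)
pose h (z : int) : int := if (0 < z)%R then arcval n s b (`|z|%N - 1)
  else if (z < 0)%R then (- arcval n s b (`|z|%N - 1))%R else 0%R.
have hN z : h (- z)%R = (- h z)%R.
  rewrite /h abszN; case: (ltrgtP z 0%R) => z0.
  - by rewrite ifT ?opprK //; lia.
  - by rewrite ifF ?ifT //; lia.
  - by rewrite z0 oppr0.
have habs z : z <> 0%R -> `|h z| = aval n s b (`|z|%N - 1).
  move=> z0; rewrite /h /arcval; do ![case: ifP => ?]; lia.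
have h0 : h 0%R = 0%R by [].
have hb z : (`|z| <= n)%N -> (`|h z| <= n)%N.
  move=> zn; have [->//|/eqP z0] := eqVneq z 0%R.
  by rewrite habs //; have := @aval_bound n s b (`|z| - 1) ltac:(lia); lia.
have hi z z' : (`|z| <= n)%N -> (`|z'| <= n)%N -> h z = h z' -> z = z'.
  have hz0 w : h w = 0%R -> w = 0%R.
    by move=> hw; apply/eqP/negPn/negP => /eqP/habs; rewrite hw.
  move=> zn zn' e; have [z0|/eqP z0] := eqVneq z 0%R.
    by rewrite z0; apply/esym/hz0; rewrite -e z0.
  have [z0'|/eqP z0'] := eqVneq z' 0%R.
    by rewrite z0'; apply/hz0; rewrite e z0'.
  have := habs _ z0; rewrite e habs // => /(aval_inj sn) => /(_ ltac:(lia) ltac:(lia)) E.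
  have [//|zz] : z = z' \/ z = (- z')%R by lia.
  by have := e; rewrite zz hN => e'; have := hz0 z'; lia.
have zb (x : 'I_(2 * n).+1) : (`|(x%:Z - n%:Z)%R| <= n)%N by have := ltn_ord x; lia.
pose f (x : 'I_(2 * n).+1) : 'I_(2 * n).+1 := inord `|(h (x%:Z - n%:Z) + n%:Z)%R|%N.
have fE x : (f x : nat)%:Z%R = (h (x%:Z - n%:Z) + n%:Z)%R.
  by rewrite /f inordK; have := hb _ (zb x); lia.
have f_inj : injective f.
  move=> x y /(congr1 (@nat_of_ord _))/(congr1 Posz); rewrite !fE => /addIr.
  by move/(hi _ _ (zb x) (zb y)) => e; apply: ord_inj; lia.
exists (perm f_inj).
  apply/hyperoctP => x; rewrite !permE; apply: ord_inj; rewrite rev_ord_val.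
  have := fE (rev_ord x); rewrite rev_ord_val.
  have -> : ((2 * n - x)%N%:Z - n%:Z = - (x%:Z - n%:Z))%R by have := ltn_ord x; lia.
  by rewrite hN; have := fE x; have := ltn_ord (f x); lia.
move=> j jn; rewrite /pval permE fE addrK inordK; last by lia.
have -> : ((n + j.+1)%N%:Z - n%:Z = j.+1%:Z)%R by lia.
by rewrite /h /= subn1.
Qed.

Lemma inZmod_iota n a k x :
  inZmod n (iota a k) x <-> exists2 t, t < k & x = a + t %[mod n].
Proof.
split=> [/hasP[y]|[t tk xt]].
  by rewrite mem_iota => yk /eqP xy; exists (y - a); rewrite ?subnKC //; lia.
by apply/hasP; exists (a + t); [rewrite mem_iota; lia|apply/eqP].
Qed.

(** Start of the cyclic interval filled by the first [k] absolute values; adding [n] keeps the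
    subtraction from truncating. *)
Definition window_start (n : nat) (s : seq bool) (b k : nat) :=
  b + 1 + n - count id (take k s).

Lemma inZmod_prefix n s b (pi : {perm 'I_(2 * n).+1}) k x : size s = n -> k <= n ->
  (forall j, j < k -> `|pval pi j.+1| = aval n s b j) ->
  inZmod n (abs_prefix pi k.+1) x <->
  exists2 t, t < k & x = window_start n s b k + t %[mod n].
Proof.
move=> sn kn d; rewrite /window_start.
have ck := count_negb (take k s); rewrite size_takel in ck; last by lia.
have off := @offset_prefix n s k _ sn kn.
split=> [/hasP[y /mapP[j]]|[t tk xt]].
  rewrite mem_iota => jk -> /eqP ->; have jj : j.-1 < k by lia.
  have := d _ jj; rewrite prednK; last by lia.
  move=> ->; rewrite aval_mod.
  have [oj|oj] := (off (offset n s j.-1)).1 (ex_intro2 _ _ j.-1 jj erefl).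
    exists (count id (take k s) + offset n s j.-1); first by lia.
    by rewrite -[LHS]modnDr; congr modn; lia.
  exists (offset n s j.-1 - (n - count id (take k s))); first by lia.
  by congr modn; lia.
have [j jk oj] : exists2 j, j < k &
    offset n s j = if t < count id (take k s) then n - count id (take k s) + t
                   else t - count id (take k s).
  by apply/off; case: ifP; lia.
apply/hasP; exists (aval n s b j).
  by rewrite -d //; apply: map_f; rewrite mem_iota; lia.
apply/eqP; rewrite aval_mod oj xt; case: ifP => ?; first by congr modn; lia.
by rewrite -[RHS]modnDr; congr modn; lia.
Qed.

Lemma eqmod_cancel n A B c i j x y : A = B %[mod n] ->
  A + i * n = c + x -> B + j * n = c + y -> x = y %[mod n].
Proof.
move=> e ex ey; apply/eqP; rewrite -(eqn_modDl c) -ex -ey.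
by rewrite ![_ + _ * n]addnC !modnMDl e.
Qed.

Lemma arc_data_signed_arc n s b (pi : {perm 'I_(2 * n).+1}) : size s = n ->
  pi \in hyperoct n -> arc_data s b pi -> pi \in signed_arc n.
Proof.
move=> sn hpi d; rewrite inE hpi /=.
have da := arc_abs d.
have pre k x : k <= n -> inZmod n (abs_prefix pi k.+1) x <->
    exists2 t, t < k & x = window_start n s b k + t %[mod n].
  by move=> kn; apply: inZmod_prefix => // j jk; apply: da; lia.
apply/andP; split; apply/allP => -[|k]; rewrite mem_iota //= => kn.
  have n0 : 0 < n by lia.
  apply/existsP; exists (Ordinal (ltn_pmod (window_start n s b k) n0)).
  have kn' : k < n.+1 by lia.
  apply/existsP; exists (Ordinal kn'); apply/forallP => x /=.
  apply/eqP; apply/idP/idP => [/pre[|t tk e]|/inZmod_iota[t tk e]]; first by lia.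
    by apply/inZmod_iota; exists t; rewrite // e modnDml.
  by apply/pre; [lia|exists t; rewrite // e modnDml].
have ck := count_negb (take k s); rewrite size_takel in ck; last by lia.
have kn' : k < n by lia.
rewrite da // d // /arcval.
(* An entry of the wrong sign adjoins the other end of the window; the tested neighbour then lies in
   the window only if [k.+1 >= n], which is excluded here. *)
apply/andP; split; apply/implyP => /pre[|t tk]; try lia.
  case: ifP => // sk; rewrite {1}/aval subn1 /= modn_mod /offset sk /window_start => e.
  have /esym/eqmod_window : n = t + 2 %[mod n].
    by apply: (eqmod_cancel (c := b + n - 1 - count id (take k s)) (i := 1) (j := 0) e); lia.
  by lia.
case: ifP => // sk; rewrite -modnDml aval_mod modnDml /offset sk /window_start => e.
have : k.+1 = t %[mod n].
  by apply: (eqmod_cancel (c := window_start n s b k) (i := 1) (j := 0) e); rewrite /window_start; lia.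
by move/esym/eqmod_window; lia.
Qed.

Lemma signed_arc_arc_data n (pi : {perm 'I_(2 * n).+1}) : 0 < n -> pi \in signed_arc n ->
  exists s b, [/\ size s = n, b < n & arc_data s b pi].
Proof.
move=> n0; rewrite inE => /andP[hpi /andP[/allP cyc /allP sgn]].
pose s := mkseq (fun j => pval pi j.+1 < 0)%R n.
have sn : size s = n by rewrite size_mkseq.
have sE j : j < n -> nth false s j = (pval pi j.+1 < 0)%R by move=> jn; rewrite nth_mkseq.
have pb j : j < n -> 0 < `|pval pi j.+1| <= n by move=> jn; apply: pval_abs.
(* A positive first entry is [b + 1]; a negative one has absolute value [b] modulo [n]. *)
pose b := if nth false s 0 then `|pval pi 1| %% n else `|pval pi 1| - 1.
have bn : b < n.
  by rewrite /b; case: ifP => _; [rewrite ltn_mod|have := pb 0 n0; lia].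
exists s, b; split=> //.
suff H k : k <= n -> forall j, j < k -> `|pval pi j.+1| = aval n s b j.
  move=> j jn; have := H n (leqnn n) j jn; have := sE j jn; rewrite /arcval => ->.
  case: ifP => c <-; rewrite abszE; first by rewrite ltr0_norm ?opprK.
  by rewrite ger0_norm // leNgt c.
elim: k => [|k IH] kn j; first by [].
have {}IH := IH ltac:(lia).
rewrite ltnS leq_eqVlt => /orP[/eqP ->|]; last exact: IH.
set x := `|pval pi k.+1|; have xb : 0 < x <= n by apply: pb.
apply: (@eqmod_bound n) => //; first exact: aval_bound.
rewrite aval_mod; have [k0|k0] := posnP k.
  subst k; rewrite /offset take0 /= /b -/x; case: ifP => _.
    rewrite (_ : x %% n + 1 + (n - 1 - 0) = x %% n + n) ?modnDr ?modn_mod //.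
    by move: (x %% n); lia.
  by congr modn; lia.
have ck := count_negb (take k s); rewrite size_takel in ck; last by lia.
have pre y := @inZmod_prefix n s b pi k y sn (ltnW kn) IH.
set w := window_start n s b k in pre.
have offk : offset n s k = if nth false s k then n - 1 - count id (take k s) else k - count id (take k s).
  by rewrite /offset; case: ifP => // _; lia.
(* The new absolute value is located by its distance [t] from the start of the window, which fills
   the distances below [k]. *)
have [t tn xt] : exists2 t, t < n & x = w + t %[mod n].
  exists ((x + n * w - w) %% n); first by rewrite ltn_mod.
  by rewrite modnDmr (_ : w + (x + n * w - w) = w * n + x) ?modnMDl //; nia.
have tk : k <= t.
  rewrite leqNgt; apply/negP => tk.
  have /pre/hasP[y /mapP[i]] : exists2 t, t < k & x = w + t %[mod n] by exists t.
  rewrite mem_iota => ik -> /eqP /eqmod_bound e.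
  have ib : 0 < `|pval pi i| <= n by apply: pval_abs; lia.
  by have := pval_abs_inj hpi _ _ (e xb ib); lia.
have wt y u u' : u < n -> u' < n -> y = w + u %[mod n] -> y = w + u' %[mod n] -> u = u'.
  move=> un un' -> /eqP; rewrite eqn_modDl => /eqP.
  by rewrite !modn_small.
have wa : w + count id (take k s) = b + 1 + n by rewrite /w /window_start; lia.
(* The prefix with [x] added is again a cyclic interval, so [x] adjoins one end of the window. *)
have tkn : t = k \/ t = n - 1.
  have [kn1|kn1] := leqP n k.+1; first by lia.
  have k2 : k.+2 \in iota 1 n by rewrite mem_iota; lia.
  have /existsP[a0 /existsP[kk /forallP W]] := cyc _ k2.
  have {W}W y : inZmod n (abs_prefix pi k.+2) y <-> exists2 u, u < kk & y = a0 + u %[mod n].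
    have inm l : inZmod n l (y %% n) = inZmod n l y by apply: eq_has => z; rewrite modn_mod.
    have /eqP := W (Ordinal (ltn_pmod y n0)); rewrite [nat_of_ord _]/= !inm => ->.
    exact: inZmod_iota.
  have {W pre}W y : (exists2 u, u < kk & y = a0 + u %[mod n]) <->
      (exists2 u, u < k & y = w + u %[mod n]) \/ y = w + t %[mod n].
    have -> : w + t = x %[mod n] by [].
    have preS : inZmod n (abs_prefix pi k.+2) y = inZmod n (abs_prefix pi k.+1) y || (y == x %[mod n]).
      by rewrite /inZmod /abs_prefix !succnK -(addn1 k) iotaD map_cat has_cat /= orbF add1n.
    rewrite -W -pre preS.
    by split=> [/orP[|/eqP]|[->//|/eqP ->]]; [left|right|rewrite orbT].
  have [|u ukk wu] := (W w).2.
    by left; exists 0; rewrite // addn0.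
  have n1n : n - 1 < n by clear -n0; lia.
  have k_n : k < n - 1 by clear -kn1; lia.
  have un v : v < k -> v < n by move=> vk; apply: ltn_trans vk kn.
  (* An interval starting before [w] contains the residue before [w], which must be the new one; an
     interval starting at [w] contains [w + k], which must be the new one. *)
  have [u0|u0] := posnP u; last first.
    right; have /W[[u' u'k e]|e] : exists2 u, u < kk & w + (n - 1) = a0 + u %[mod n].
    - exists u.-1; first exact: leq_ltn_trans (leq_pred u) ukk.
      by apply: (eqmod_cancel (c := 1) (i := 1) (j := 0) wu); [clear -n0|clear -u0]; lia.
    - have E := wt _ _ _ n1n (un _ u'k) erefl e.
      by move: u'k k_n; rewrite -E; clear; lia.
    - by rewrite (wt _ _ _ n1n tn erefl e).
  left; subst u; rewrite addn0 in wu.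
  have wa0 v : a0 + v = w + v %[mod n] by rewrite -modnDml -wu modnDml.
  have [|u' u'kk e] := (W (w + t)).2; first by right.
  have u'n : u' < n by apply: leq_trans u'kk _; rewrite -ltnS; apply: ltn_ord.
  rewrite wa0 in e; have tu' := wt _ _ _ tn u'n erefl e.
  have /W[[v vk e']|e'] : exists2 u, u < kk & w + k = a0 + u %[mod n].
  - by exists k; [apply: leq_ltn_trans tk _; rewrite tu'|rewrite wa0].
  - by have E := wt _ _ _ kn (un _ vk) erefl e'; rewrite E ltnn in vk.
  - by rewrite (wt _ _ _ kn tn erefl e').
have sgnk : k.+1 < n -> (t = k -> nth false s k = false) /\ (t = n - 1 -> nth false s k).
  move=> kn1; have k1 : k.+1 \in iota 1 n.-1 by rewrite mem_iota; lia.
  have /andP[/implyP s1 /implyP s2] := sgn _ k1; rewrite sE //; split=> tE.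
    rewrite tE in xt; apply: negbTE; rewrite -leNgt ltW // s1 //; apply/pre; exists k.-1; first by lia.
    by apply: (eqmod_cancel (c := 1) (i := 0) (j := 0) xt); rewrite -/x; move: xb k0; clear; lia.
  apply: s2; apply/pre; exists 0; first by lia.
  by rewrite -/x -modnDml xt modnDml tE addn0 -addnA subnK // modnDr.
(* The sign selects the end; for the last entry both ends are the same residue. *)
rewrite xt offk; case: ifP => sk.
  have -> : t = n - 1.
    by have [kn1|kn1] := ltnP k.+1 n;
      [have [] := sgnk kn1; case: tkn => // tE /(_ tE); rewrite sk|lia].
  by rewrite -[RHS]modnDr; congr modn; lia.
have -> : t = k.
  by have [kn1|kn1] := ltnP k.+1 n;
    [have [_] := sgnk kn1; case: tkn => // tE /(_ tE); rewrite sk|lia].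
by rewrite -[RHS]modnDr; congr modn; lia.
Qed.

(** * Counting compatible permutations *)

Definition labels (c : nat -> nat) (v : nat) : seq nat := flatten [seq nseq (c u) u | u <- iota 0 v].

Lemma labelsS c v : labels c v.+1 = labels c v ++ nseq (c v) v.
Proof. by rewrite /labels -(addn1 v) iotaD map_cat flatten_cat /= cats0. Qed.

Lemma labels_lt c v u : u \in labels c v -> u < v.
Proof.
elim: v => [//|v IH]; rewrite labelsS mem_cat => /orP[/IH|]; first by lia.
by move=> /nseqP[-> _].
Qed.

Lemma count_labels c v u : count_mem u (labels c v) = if u < v then c u else 0.
Proof.
elim: v => [//|v IH]; rewrite labelsS count_cat IH count_nseq /=.
by have [uv|uv|->] := ltngtP u v; rewrite ?mul1n ?mul0n ?addn0 ?ltnS ?ltnn; do ?[case: ifP => ?]; lia.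
Qed.

Lemma labels_sorted c v : sorted leq (labels c v).
Proof.
rewrite sorted_pairwise; last exact: leq_trans.
elim: v => [//|v IH]; rewrite labelsS pairwise_cat IH /=; apply/andP; split.
  by apply/allrelP => x y /labels_lt xv /nseqP[-> _]; exact: ltnW.
by elim: (c v) => //= k ->; rewrite andbT all_nseq leqnn orbT.
Qed.

(* Entries with equal labels must not form a descent; a positive entry followed
   by a negative one always does. *)
Definition okword (l : seq nat) (s : seq bool) := forall i, i < size l ->
  nth 0 (0 :: l) i = nth 0 (0 :: l) i.+1 -> nth false (false :: s) i.+1 ->
  nth false (false :: s) i.

(** These are the inner steps of the pieces. *)
Definition adjacent (l : seq nat) (s : seq bool) (i : nat) :=
  [&& 0 < i, nth 0 l i.-1 == nth 0 l i & nth false s i.-1 == nth false s i].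

Definition adjacents (l : seq nat) (s : seq bool) : seq nat :=
  [seq i <- iota 0 (size l) | adjacent l s i].

Lemma nth_block c d j :
  nth false (nseq d true ++ nseq (c - d) false) j = (j < d).
Proof.
by rewrite nth_cat size_nseq !nth_nseq if_same; case: (j < d).
Qed.

(** In a block of [c] entries whose first [d] are negative, pieces start only at positions 0 and
    [d]. *)
Lemma block_pieces c d : d <= c ->
  count (fun j => (0 < j) && (j != d)) (iota 0 c) + (d < c) + (0 < d) = c.
Proof.
have H k : count (fun j => (0 < j) && (j != d)) (iota 0 k) + (0 < k) + (0 < d < k) = k.
  elim: k => [|k IH]; first by rewrite /= ltn0 andbF.
  by rewrite -(addn1 k) iotaD count_cat /= add0n; lia.
by move=> dc; have := H c; lia.
Qed.

Section Append.
Variables (l : seq nat) (s : seq bool) (v : nat).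
Hypotheses (sl : size s = size l) (lv : forall u, u \in l -> u < v).

Lemma adjacents_block c d : d <= c ->
  size (adjacents (l ++ nseq c v) (s ++ nseq d true ++ nseq (c - d) false)) + (d < c) + (0 < d) =
  size (adjacents l s) + c.
Proof.
move=> dc; rewrite /adjacents !size_filter size_cat size_nseq iotaD count_cat.
have -> : count (adjacent (l ++ nseq c v) (s ++ nseq d true ++ nseq (c - d) false)) (iota 0 (size l))
    = count (adjacent l s) (iota 0 (size l)).
  apply: eq_in_count => i; rewrite mem_iota => /= il.
  by rewrite /adjacent !(nth_cat _ _ _ i) !(nth_cat _ _ _ i.-1) sl !(leq_ltn_trans (leq_pred i) il) il.
rewrite add0n -[in iota _ c](addn0 (size l)) iotaDl count_map.
rewrite -[in RHS](block_pieces dc) !addnA; congr (_ + _ + _ + _); apply: eq_in_count => j.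
rewrite mem_iota /= => jc; rewrite /adjacent.
(* The new label exceeds all earlier ones, so a block starts a new piece. *)
have [j0|j0] := posnP j.
  subst j; rewrite addn0; apply/negP => /and3P[l0 /eqP + _].
  rewrite nth_cat ifT; last by rewrite prednK.
  rewrite nth_cat ltnn subnn nth_nseq jc => e.
  by have := lv (mem_nth 0 (_ : (size l).-1 < size l)); rewrite prednK // e ltnn => /(_ (leqnn _)).
have nthr (T : Type) (x0 : T) (t u : seq T) k : size t = size l ->
    nth x0 (t ++ u) (size l + k) = nth x0 u k.
  by move=> <-; rewrite nth_cat ltnNge leq_addr /= addKn.
have -> : (size l + j).-1 = size l + j.-1 by lia.
rewrite !nthr // !nth_nseq !nth_block jc (leq_ltn_trans (leq_pred j) jc) eqxx addn_gt0 j0 orbT /=.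
lia.
Qed.

Let nth_right (T : Type) (x0 x1 : T) (r u : seq T) k : size r = size l ->
  nth x0 (x1 :: r ++ u) (size l + k).+1 = nth x0 u k.
Proof. by move=> <- /=; rewrite nth_cat ltnNge leq_addr /= addKn. Qed.

Let nth_left (T : Type) (x0 x1 : T) (r u : seq T) k : size r = size l -> k <= size l ->
  nth x0 (x1 :: r ++ u) k = nth x0 (x1 :: r) k.
Proof. by move=> <- kr; rewrite -cat_cons nth_cat ifT //= ltnS. Qed.

Lemma okword_prefix t c : okword (l ++ nseq c v) (s ++ t) -> okword l s.
Proof.
move=> ok i il e; have := ok i; rewrite size_cat (ltn_addr _ il) => /(_ isT).
by have il' := ltnW il; rewrite !nth_left // => /(_ e).
Qed.

Lemma okword_block c t : size t = c -> okword (l ++ nseq c v) (s ++ t) ->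
  exists2 d, (d <= if v == 0 then 0 else c) & t = nseq d true ++ nseq (c - d) false.
Proof.
move=> tc ok.
have step j : 0 < j < c -> nth false t j -> nth false t j.-1.
  case/andP; case: j => // j _ jc; have := ok (size l + j.+1); rewrite size_cat size_nseq ltn_add2l.
  move=> /(_ jc); rewrite addnS !nth_right // -addnS !nth_right // !nth_nseq jc (ltnW jc).
  by apply.
have {}step k j : k <= j < c -> nth false t j -> nth false t k.
  elim: j => [|j IH] kj; first by have -> : k = 0 by lia.
  have [->//|kj'] := eqVneq k j.+1; move=> /step tj.
  by apply: IH; [lia|apply: tj; lia].
(* [d] is the length of the leading run of negative signs; within the block no negative sign follows
   a positive one. *)
have [d dE] : exists d, d <= c /\ forall j, j < c -> nth false t j = (j < d).
  exists (find negb t); split; first by rewrite -tc find_size.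
  move=> j jc; case: ltnP => jf; first by have := before_find false jf => /negbFE.
  apply: negbTE; apply/negP => tj; have fc : has negb t by rewrite has_find tc; lia.
  by have := nth_find false fc; rewrite (@step _ j) //; lia.
exists d.
  (* At label 0 the first entry is compared with the prepended label 0 of positive sign, so it
     cannot be negative. *)
  case: (eqVneq v 0) => [v0|//]; last by case: dE.
  have l0 : l = [::] by case: l lv => [//|x r] /(_ x (mem_head _ _)); rewrite v0.
  have [c0|c0] := posnP c; first by have := dE.1; rewrite c0.
  rewrite leqNgt; apply/negP => d0.
  move: ok; rewrite l0 (size0nil (etrans sl (congr1 size l0))) => /(_ 0).
  by rewrite /= size_nseq nth_nseq c0 v0 (dE.2 0 c0) d0 => /(_ isT erefl isT).
apply: (@eq_from_nth _ false); first by rewrite size_cat !size_nseq subnKC ?dE.1.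
by move=> j; rewrite tc => jc; rewrite nth_block dE.2.
Qed.

Lemma okword_append c d : (d <= if v == 0 then 0 else c) -> okword l s ->
  okword (l ++ nseq c v) (s ++ nseq d true ++ nseq (c - d) false).
Proof.
move=> dv ok i; rewrite size_cat size_nseq => ilc.
have [il|il] := ltnP i (size l).
  by have il' := ltnW il; rewrite !nth_left //; apply: ok.
rewrite -(subnKC il) in ilc *; move: (i - _) ilc => {il}i; rewrite ltn_add2l => ic.
rewrite !nth_right // nth_nseq ic nth_block.
case: i ic => [|i] ic; last by rewrite addnS !nth_right // nth_block; lia.
rewrite addn0 => e d0; exfalso.
have v0 : v != 0 by move: dv; case: (v == 0) => //; rewrite leqn0 => /eqP d00; rewrite d00 in d0.
case: l lv e {ok} => [_ /= e|x r lv']; first by rewrite -e eqxx in v0.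
rewrite -cat_cons nth_cat /= ltnS leqnn => /= e.
by have := lv' _ (mem_nth 0 (leqnn _ : size r < size (x :: r))); rewrite e ltnn.
Qed.

End Append.

Lemma size_labelsS c v : size (labels c v.+1) = size (labels c v) + c v.
Proof. by rewrite labelsS size_cat size_nseq. Qed.

Lemma words_okword c v w : w \in words c v ->
  [/\ size w.1.1 = size (labels c v), okword (labels c v) w.1.1
    & w.1.2 + w.2 + size (adjacents (labels c v) w.1.1) = size (labels c v)].
Proof.
elim: v w => [|v IH] w; first by rewrite inE => /eqP ->; split=> //= -[].
rewrite wordsS => /allpairsPdep[[[s P] M] [d [/IH /= [ss ok adj]]]].
rewrite mem_iota add0n => /andP[_ dc] ->.
have dv : d <= if v == 0 then 0 else c v by move: dc; case: (v == 0).
have dc' : d <= c v by move: dv; case: (v == 0) => //; lia.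
have lv := @labels_lt c v.
have H := adjacents_block ss lv dc'.
rewrite size_labelsS labelsS /wext /=; split; last by lia.
  by rewrite !size_cat !size_nseq ss subnKC.
exact: okword_append.
Qed.

Lemma okword_words c v s : size s = size (labels c v) -> okword (labels c v) s ->
  exists2 w, w \in words c v & w.1.1 = s.
Proof.
elim: v s => [|v IH] s.
  by move=> /size0nil -> _; exists ([::], 0, 0); rewrite ?inE.
rewrite size_labelsS labelsS -{2}(cat_take_drop (size (labels c v)) s) => ss ok.
have st : size (take (size (labels c v)) s) = size (labels c v).
  by rewrite size_takel // ss leq_addr.
have sd : size (drop (size (labels c v)) s) = c v by rewrite size_drop ss addKn.
have [w ww we] := IH _ st (okword_prefix st ok).
have [d dv de] := okword_block st (@labels_lt c v) sd ok.
exists (wext (c v) d w).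
  rewrite wordsS; apply/allpairsPdep; exists w, d; split=> //.
  by rewrite mem_iota /=; case: (v == 0) dv.
case: w we {ww} => [[s' P] M] /= we.
by rewrite we -de cat_take_drop.
Qed.

Lemma words_uniq c v :
  uniq (words c v) /\ {in words c v &, injective (fun w : word => w.1.1)}.
Proof.
elim: v => [|v [uw wi]].
  by split=> // w w'; rewrite !inE => /eqP -> /eqP ->.
have ext_inj w w' d d' : w \in words c v -> w' \in words c v -> d <= c v -> d' <= c v ->
    (wext (c v) d w).1.1 = (wext (c v) d' w').1.1 -> w = w' /\ d = d'.
  move=> ww ww' dc dc' e.
  have [sw _ _] := words_okword ww; have [sw' _ _] := words_okword ww'.
  move: e; case: w ww sw => [[s P] M] ww sw; case: w' ww' sw' => [[s' P'] M'] ww' sw' /eqP.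
  rewrite /= eqseq_cat ?sw ?sw' // => /andP[/eqP es /eqP /(congr1 (count id))].
  rewrite !count_cat !count_nseq /= => ed; split; last by lia.
  exact: wi.
have dP d : d \in iota 0 (if v == 0 then 1 else (c v).+1) -> d <= c v.
  by rewrite mem_iota add0n => /andP[_]; case: ifP => _; lia.
rewrite wordsS; split.
  apply: allpairs_uniq_dep => [//|w _|]; first exact: iota_uniq.
  move=> [w d] [w' d'] /allpairsPdep[x [y [xw /dP yd [-> ->]]]].
  move=> /allpairsPdep[x' [y' [xw' /dP yd' [-> ->]]]] /= e.
  by have [-> ->] := ext_inj _ _ _ _ xw xw' yd yd' (congr1 (fun w : word => w.1.1) e).
move=> w w' /allpairsPdep[x [y [xw /dP yd ->]]] /allpairsPdep[x' [y' [xw' /dP yd' ->]]] e.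
by have [-> ->] := ext_inj _ _ _ _ xw xw' yd yd' e.
Qed.

(* Between adjacent positions i - 1 and i of a piece, the absolute values pass
   between n and 1 exactly when b + wrap_shift n s i is 0 modulo n. *)
Definition wrap_shift (n : nat) (s : seq bool) (i : nat) := maxn (offset n s i.-1) (offset n s i).

Lemma offset_step n s i : size s = n -> 0 < i < n -> nth false s i.-1 = nth false s i ->
  if nth false s i then offset n s i.-1 = (offset n s i).+1
  else offset n s i = (offset n s i.-1).+1.
Proof.
move=> sn; case: i => // i /andP[_ ii] e; rewrite /= in e *.
have [e1 e2] := @count_take s i ltac:(lia).
have ck := count_negb (take i s); rewrite size_takel in ck; last by lia.
by rewrite /offset e e1 e2 e; case: (nth _ _ _); lia.
Qed.

(** Within a piece the absolute values move by one modulo [n], upwards for positive and downwards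
    for negative entries, so the values increase except at the passage between [n] and 1. *)
Lemma arcval_descent n s b i : size s = n -> 0 < i < n ->
  (arcval n s b i < arcval n s b i.-1)%R =
  if nth false s i.-1 == nth false s i then (b + wrap_shift n s i) %% n == 0 else nth false s i.
Proof.
move=> sn ii; have n0 : 0 < n by lia.
rewrite /arcval; case: eqP => e; last first.
  have := @aval_bound n s b i n0; have := @aval_bound n s b i.-1 n0.
  by move: e; case: (nth _ _ _); case: (nth _ _ _) => //= _; lia.
have suc x : ((x.+1 %% n).+1 < (x %% n).+1) = (x.+1 %% n == 0).
  rewrite modnS; case: ifP => [nx|_]; last by lia.
  rewrite eqxx ltnS lt0n; apply/negP => /eqP x0; move: nx.
  by rewrite -addn1 dvdn_addr ?/dvdn ?x0 // modn_small; lia.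
have := offset_step sn ii e; rewrite e /wrap_shift; case: (nth _ _ _) => o.
  rewrite o (maxn_idPl (leqnSn _)) ltrN2 ltz_nat /aval o addnS; exact: suc.
by rewrite o (maxn_idPr (leqnSn _)) ltz_nat /aval o addnS; exact: suc.
Qed.

(** Offsets are injective. A negative and a positive step with equal shifts would share a position,
    which cannot have both signs. *)
Lemma wrap_shift_inj n s : size s = n ->
  {in [pred i | (0 < i < n) && (nth false s i.-1 == nth false s i)] &, injective (wrap_shift n s)}.
Proof.
move=> sn i i'; rewrite !inE => /andP[ii /eqP e] /andP[ii' /eqP e'].
have := offset_step sn ii e; have := offset_step sn ii' e'; rewrite /wrap_shift.
have oi j k := @offset_inj n s j k sn.
case si : (nth false s i); case si' : (nth false s i') => -> ->.
- rewrite !(maxn_idPl (leqnSn _)) => -[] /oi; apply; lia.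
- rewrite (maxn_idPl (leqnSn _)) (maxn_idPr (leqnSn _)) => E.
  have o1 := offset_step sn ii e; have o2 := offset_step sn ii' e'; rewrite si si' in o1 o2.
  have := oi i.-1 i' ltac:(lia) ltac:(lia) ltac:(lia) => ei.
  by move: e; rewrite ei si' si.
- rewrite (maxn_idPl (leqnSn _)) (maxn_idPr (leqnSn _)) => E.
  have o1 := offset_step sn ii e; have o2 := offset_step sn ii' e'; rewrite si si' in o1 o2.
  have := oi i'.-1 i ltac:(lia) ltac:(lia) ltac:(lia) => ei.
  by move: e'; rewrite ei si' si.
- rewrite !(maxn_idPr (leqnSn _)) => -[] /oi => ei.
  have := ei ltac:(lia) ltac:(lia); lia.
Qed.

Lemma wrap_shift_bound n s i : size s = n -> 0 < i < n -> nth false s i.-1 = nth false s i ->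
  0 < wrap_shift n s i < n.
Proof.
move=> sn ii e; have := offset_step sn ii e; rewrite /wrap_shift.
have := @offset_lt n s i sn ltac:(lia); have := @offset_lt n s i.-1 sn ltac:(lia).
by case: (nth _ _ _) => ? ? ?; lia.
Qed.

(** Each [i] in [A] excludes exactly one residue, [n - K i], and these differ. *)
Lemma avoid_count n (K : nat -> nat) (A : seq nat) : uniq A -> {in A &, injective K} ->
  {in A, forall i, 0 < K i < n} ->
  size [seq b <- iota 0 n | all (fun i => (b + K i) %% n != 0) A] + size A = n.
Proof.
move=> uA Ki Kb; pose p b := all (fun i => (b + K i) %% n != 0) A.
have e : count p (iota 0 n) + count (predC p) (iota 0 n) = n by rewrite count_predC size_iota.
apply: etrans _ e; rewrite size_filter; congr (_ + _).
rewrite -size_filter -(size_map (fun i => n - K i)); apply/perm_size/uniq_perm.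
- rewrite map_inj_in_uniq // => i j iA jA e; apply: Ki => //.
  by have := Kb _ iA; have := Kb _ jA; lia.
- by rewrite filter_uniq ?iota_uniq.
move=> b; rewrite mem_filter mem_iota add0n /p /= -has_predC.
apply/mapP/andP => [[i iA ->]|[/hasP[i iA /=]]].
  have := Kb _ iA; split; last by lia.
  by apply/hasP; exists i => //=; rewrite subnK ?modnn //; lia.
rewrite negbK => /eqP bK bn; exists i => //; have := Kb _ iA => ?.
have : b + K i = n %[mod n] by rewrite bK modnn.
have [bl|bl] := leqP (b + K i) n.
  by move/eqmod_window => /(_ ltac:(lia)); lia.
by move/esym/eqmod_window => /(_ ltac:(lia)); lia.
Qed.

(** * Coefficients of the fundamental quasisymmetric functions *)

Definition compatible n (I : {set 'I_n}) (l : seq nat) :=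
  [forall j : 'I_n, (j \in I) ==> (nth 0 (0 :: l) j < nth 0 (0 :: l) j.+1)].

Lemma mset_labels (m : {mset nat}%mset) v : (forall u, v <= u -> m u = 0) ->
  seq_mset (labels m v) = m.
Proof.
by move=> mv; apply/msetP => u; rewrite mset_seqE count_labels; case: ltnP => // /mv.
Qed.

(** The labels of a monomial have a single weakly increasing arrangement, so the coefficient is 0 or
    1. *)
Lemma fundB_labels n (I : {set 'I_n}) (m : {mset nat}%mset) v :
  (forall u, v <= u -> m u = 0) ->
  fundB I m = ((size (labels m v) == n) && compatible I (labels m v))%:R%R.
Proof.
move=> mv; have lm := mset_labels mv.
have uniql (t : n.-tuple nat) : path leq 0 t -> seq_mset t = m -> tval t = labels m v.
  move=> pt tm; apply: (sorted_eq leq_trans anti_leq).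
  - by apply: path_sorted pt.
  - exact: labels_sorted.
  - by apply/eq_seq_msetP; rewrite lm.
case: (boolP ((_ == n) && _)) => [/andP[/eqP sl /forallP cI]|no].
  have sl' : size (labels m v) == n by rewrite sl.
  rewrite /fundB (@genfun_size _ _ _ _ [:: Tuple sl']) // => t; rewrite inE; split.
    move=> /eqP ->; split=> //; split; last by move=> j; move/implyP: (cI j).
    by rewrite path_min_sorted ?labels_sorted //; apply/allP.
  by case=> -[pt _] tm; apply/eqP/val_inj; apply: uniql.
rewrite /fundB (@genfun_size _ _ _ _ [::]) // => t; split=> // -[[pt cI] tm]; case/negP: no.
rewrite -(uniql t pt tm) size_tuple eqxx /=.
by apply/forallP => j; apply/implyP; exact: cI.
Qed.

(** Equal labels must not carry a descent: [okword] treats the descents at sign changes and at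
    position 0, the condition on [b] those inside a piece. *)
Lemma compatible_Des n s b (pi : {perm 'I_(2 * n).+1}) l : size s = n -> size l = n ->
  sorted leq l -> pi \in hyperoct n -> arc_data s b pi ->
  compatible (Des pi) l <->
  okword l s /\ all (fun i => (b + wrap_shift n s i) %% n != 0) (adjacents l s).
Proof.
move=> sn ln sl hpi d.
have le0 i : i < n -> nth 0 (0 :: l) i <= nth 0 (0 :: l) i.+1.
  have p0 : path leq 0 l by rewrite path_min_sorted //; apply/allP.
  by move=> ii; apply: (pathP 0 p0); rewrite ln.
have DE (j : 'I_n) : (j \in Des pi) =
    if j == 0 :> nat then nth false s 0 else (arcval n s b j < arcval n s b j.-1)%R.
  rewrite inE; case: j => -[|i] ii /=; last by rewrite !d // ltnW.
  by rewrite pval0 // d // /arcval; case: ifP => _; have := @aval_bound n s b 0; lia.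
split=> [/forallP cD|[ok /allP av]].
  split=> [i il e|].
    apply: contraLR => si; rewrite ln in il; have := cD (Ordinal il).
    rewrite DE /= e ltnn implybF; case: i il si e => [|i] il si e /=; first by case: nth.
    rewrite arcval_descent // /= in si *.
    by rewrite (negPf si); case: (nth false s i.+1) => //=; rewrite implybT.
  apply/allP => -[|i]; rewrite mem_filter // mem_iota add0n ln.
  case/andP=> /and3P[_ /eqP e /eqP e'] /andP[_ il].
  have := cD (Ordinal il); rewrite DE /= arcval_descent //= e' eqxx.
  by move: e => /= ->; rewrite ltnn implybF.
apply/forallP => -[i il]; apply/implyP; rewrite DE /= => D.
have := le0 i il; rewrite leq_eqVlt => /orP[/eqP e|//]; exfalso.
case: i il D e => [|i] il /= D e; first by have := ok 0; rewrite ln => /(_ il e D).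
move: D; rewrite arcval_descent //=; case: eqP => es.
  apply/negP; apply: av; rewrite mem_filter mem_iota add0n ln il andbT.
  by rewrite /adjacent /= e es !eqxx.
move=> si; have := ok i.+1; rewrite ln il => /(_ isT e); rewrite /= si => /(_ isT) si'.
by rewrite si si' in es.
Qed.

Definition arc_perm n (s : seq bool) (b : nat) : {perm 'I_(2 * n).+1} :=
  odflt 1%g [pick pi : {perm 'I_(2 * n).+1} | (pi \in hyperoct n) &&
    [forall j : 'I_n, pval pi j.+1 == arcval n s b j]].

Lemma arc_permP n s b : size s = n ->
  arc_perm n s b \in hyperoct n /\ arc_data s b (arc_perm n s b).
Proof.
move=> sn; rewrite /arc_perm; case: pickP => [pi /andP[hpi /forallP d]|no].
  by split=> // j jn; apply/eqP; exact: (d (Ordinal jn)).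
have [pi hpi d] := @arc_data_exists n s b sn.
by have := no pi; rewrite hpi /=; move/negP; case; apply/forallP => j; rewrite d.
Qed.

Lemma arc_data_inj n s s' b b' (pi : {perm 'I_(2 * n).+1}) : size s = n -> size s' = n ->
  b < n -> b' < n -> arc_data s b pi -> arc_data s' b' pi -> s = s' /\ b = b'.
Proof.
move=> sn sn' bn bn' d d'; have ss : s = s'.
  apply: (@eq_from_nth _ false); rewrite ?sn ?sn' // => j jn.
  by have := d _ jn; rewrite d' // /arcval; do 2 case: (nth _ _ _) => //; rewrite /aval; lia.
subst s'; split=> //; have n0 : 0 < n by lia.
have := arc_abs d n0; rewrite (arc_abs d' n0) => -[/eqP].
by rewrite eqn_modDr !modn_small // => /eqP ->.
Qed.

(** For each sign word, every inner step of a piece excludes one residue [b], which leaves [P + M]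
    of the [n] residues. *)
Lemma card_compatible n (c : nat -> nat) v (l := labels c v) : 0 < n -> size l = n ->
  #|[set pi in signed_arc n | compatible (Des pi) l]| =
  \sum_(w <- words c v) (w.1.2 + w.2).
Proof.
move=> n0 ln.
pose good s := [seq b <- iota 0 n | all (fun i => (b + wrap_shift n s i) %% n != 0) (adjacents l s)].
pose L := [seq arc_perm n w.1.1 b | w <- words c v, b <- good w.1.1].
have wsize w : w \in words c v -> size w.1.1 = n by case/words_okword => ->.
have [uw wi] := words_uniq c v.
have uL : uniq L.
  apply: allpairs_uniq_dep => [//|w _|]; first by rewrite filter_uniq ?iota_uniq.
  move=> [w b] [w' b'] /allpairsPdep[x [y [xw + [-> ->]]]].
  rewrite mem_filter mem_iota => /andP[_ yn].
  move=> /allpairsPdep[x' [y' [xw' + [-> ->]]]].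
  rewrite mem_filter mem_iota => /andP[_ yn'] /= e.
  have [_ d] := @arc_permP n x.1.1 y (wsize _ xw).
  have [_ d'] := @arc_permP n x'.1.1 y' (wsize _ xw'); rewrite -e in d'.
  have [es ->] := arc_data_inj (wsize _ xw) (wsize _ xw') yn yn' d d'.
  by have -> : x = x' by exact: wi.
have memL : L =i [set pi in signed_arc n | compatible (Des pi) l].
  move=> pi; rewrite inE; apply/allpairsPdep/andP.
    case=> w [b [ww + ->]]; rewrite mem_filter => /andP[av _].
    have sn := wsize _ ww; have [hpi d] := @arc_permP n w.1.1 b sn.
    split; first exact: arc_data_signed_arc hpi d.
    by apply/(compatible_Des sn ln (labels_sorted c v) hpi d); have [] := words_okword ww.
  case=> api cD; have [s [b [sn bn d]]] := signed_arc_arc_data n0 api.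
  have hpi : pi \in hyperoct n by move: api; rewrite inE => /andP[].
  have [ok av] := (compatible_Des sn ln (labels_sorted c v) hpi d).1 cD.
  have [w ww ws] : exists2 w, w \in words c v & w.1.1 = s by apply: okword_words; rewrite ?sn.
  exists w, b; rewrite ws; split=> //; first by rewrite mem_filter av mem_iota.
  have [hrho d'] := @arc_permP n s b sn.
  by apply: hyperoct_ext => // j jn; rewrite d // d'.
rewrite -(eq_card memL) (card_uniqP uL) size_allpairs_dep sumnE big_map.
rewrite big_seq [RHS]big_seq; apply: eq_bigr => w ww.
have [sw _ adj] := words_okword ww; have sn := wsize _ ww.
have adjP i : i \in adjacents l w.1.1 -> (0 < i < n) && (nth false w.1.1 i.-1 == nth false w.1.1 i).
  by rewrite mem_filter mem_iota add0n ln => /andP[/and3P[-> _ ->] /andP[_ ->]].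
suff : size (good w.1.1) + size (adjacents l w.1.1) = n.
  by rewrite -[in RHS]ln -[in RHS]adj => /addIn.
apply: avoid_count.
- by rewrite filter_uniq ?iota_uniq.
- by move=> i j /adjP iP /adjP jP; apply: wrap_shift_inj.
- by move=> i /adjP/andP[ii /eqP e]; exact: wrap_shift_bound.
Qed.

Lemma sum_fundB n : 0 < n ->
  (\sum_(pi in signed_arc n) fundB (Des pi) = \sum_(lam <- shapes n) domfun lam)%R.
Proof.
move=> hn; apply/funext => m; rewrite !fct_sumE /=.
have [v mv] : exists v, forall u, v <= u -> m u = 0.
  exists (\max_(u <- m : seq nat) u).+1 => u vu; apply/mset_eq0P/negP => um.
  by have := @leq_bigmax_seq _ (m : seq nat) xpredT id u um isT; rewrite leqNgt vu.
rewrite (domfun_shapes hn mv).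
under eq_bigr do rewrite (fundB_labels _ mv).
under [in RHS]eq_bigr do rewrite size_tableaux.
rewrite exchange_big /=.
(* All words have as many signs as the monomial has labels, so they contribute together or not at
   all. *)
have -> : \sum_(w <- words m v) \sum_(x <- codes n) contrib x w =
    \sum_(w <- words m v) if size (labels m v) == n then w.1.2 + w.2 else 0.
  rewrite big_seq [RHS]big_seq; apply: eq_bigr => w ww.
  rewrite (sum_contrib hn (words_wf ww)); have [<- _ _] := words_okword ww.
  by rewrite /npos /nneg addnC count_negb.
case: eqP => [ln|_] /=; last by rewrite !big1.
rewrite -(card_compatible hn ln) -sum1_card natr_sum [RHS]big_mkcond [LHS]big_mkcond /=.
apply: eq_bigr => pi _; rewrite [in RHS]inE.
by case: (pi \in signed_arc n) => //=; case: (compatible _ _).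
Qed.

Local Open Scope ring_scope.

Theorem theorem1 (n : nat) (hn : (1 <= n)%N) :
  G_positive (signed_arc n) /\
  \sum_(pi in signed_arc n) fundB (Des pi) =
    domfun [:: (2 * n)%N]
    + domfun [:: (2 * n - 1)%N; 1%N]
    + domfun [:: (2 * n - 2)%N; 1%N; 1%N]
    + domfun [:: (2 * n - 3)%N; 1%N; 1%N; 1%N]
    + (\sum_(0 <= a < (2 * n).+1 | (2 <= 2 * n - a <= a)%N)
         domfun [:: a; (2 * n - a)%N]) *+ 2
    + \sum_(0 <= a < (2 * n).+1 | (2 <= 2 * n - a - 2 <= a)%N)
         domfun [:: a; (2 * n - a - 2)%N; 2%N]
    + \sum_(0 <= a < (2 * n).+1 | (2 <= 2 * n - a - 2 <= a)%N)
         domfun [:: a; (2 * n - a - 2)%N; 1%N; 1%N].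
Proof.
have E := sum_fundB hn; rewrite -sum_shapes; split=> //.
by apply: G_positive_seq E; apply: sumn_shapes.
Qed.
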